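(* Let $\ell\ge1$, $b>2(e\ell)^{1/\ell}$, and let $\beta$, $x_0$, $R$ and $F_0:U\to B^*(0,R)$ be as in the context. Then $F_0\in\mathcal F$ (with $V=B(0,R)$). Moreover, if $c\in U$ then $F_c=F_0+c$ satisfies the robust separation property $$B(c,R)\supset\overline{B(c;\operatorname{diam}(U))}\supset U .$$ In particular, for the family $f_c:\mathbb R\to\mathbb R$, $f_c(x)=be^{-1/|x|^\ell}+c$ for $x\neq0$, $f_c(0)=c$ (the real family given by $F_c$), the kneading sequence depends monotonically on $c\in[-\beta,\infty)$.
   Context: $B(x,r)$ is the open disc of radius $r$ centred at $x$, $B^*(x,r)=B(x,r)\setminus\{x\}$; for a bounded open interval $J\subset\mathbb R$, $D_*(J)$ is the open Euclidean disc with diameter $J$. **Class $\mathcal F$.** Holomorphic maps $f:U\to V$ such that $U$ is a bounded open set with $0\in\overline U$; $V$ is a bounded open set; $f:U\setminus\{0\}\to V\setminus\{0\}$ is an unbranched covering; $V\supset B(0;\operatorname{diam}(U))\supset U$. **Constants.** Since $b>2(e\ell)^{1/\ell}$, the equation $b=2xe^{1/x^\ell}$ has a unique solution $x=\beta\in(0,\ell^{1/\ell})$; then $f_{-\beta}(0)=-\beta$, $f_{-\beta}(\beta)=\beta$ and $Df_{-\beta}(\beta)>2$. Choose $x_0>\beta$, close to $\beta$, such that $x_1:=f_{-\beta}(x_0)$ satisfies $x_1>x_0$, $x_1-\beta>2(x_0-\beta)$ and $R:=f_0(x_0)=x_1+\beta<b$. **The map $F_0$.** Let $\Phi(re^{i\theta})=r^\ell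 e^{i\ell\theta}$ be the conformal map from the sector $\{re^{i\theta}:|\theta|<\pi/(2\ell)\}$ onto the right half-plane, $U^+=\Phi^{-1}(D_*((0,x_0^\ell)))$, $U^-=-U^+$, $U=U^+\cup U^-$, $F_0(z)=be^{-1/\Phi(z)}$ on $U^+$ and $F_0(z)=be^{-1/\Phi(-z)}$ on $U^-$. It extends $f_0:(-x_0,0)\cup(0,x_0)\to(0,R)$. **Kneading sequence.** For a unimodal $f:\mathbb R\to\mathbb R$ strictly decreasing on $(-\infty,0]$ and strictly increasing on $[0,\infty)$, $\mathcal K(f)=i_1i_2\cdots$ with $i_k=1,0,-1$ according as $f^k(0)>0$, $=0$, $<0$. $\mathcal K(f)\prec\mathcal K(g)$, $\mathcal K(g)=j_1j_2\cdots$, if for some $n\ge1$, $i_k=j_k$ for $1\le k<n$ and $\prod_{k=1}^ni_k<\prod_{k=1}^nj_k$. *)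

(* Defs.v *)
From Stdlib Require Import Reals Lra.
From Coquelicot Require Import Coquelicot.
Open Scope R_scope.

(** ** Subsets of the complex plane *)

Definition Csubset (A B : C -> Prop) : Prop := forall z, A z -> B z.

(* Euclidean disc: Coquelicot's own [ball] on [C] is a square, although it
   induces the same topology. *)
Definition open_disc (x : C) (r : R) : C -> Prop := fun z => Cmod (z - x)%C < r.

Definition punctured (A : C -> Prop) : C -> Prop :=
  fun z => A z /\ z <> RtoC 0.

Definition Cbounded (A : C -> Prop) : Prop :=
  exists M : R, forall z, A z -> Cmod z <= M.

Definition closure (A : C -> Prop) : C -> Prop :=
  fun z => forall eps : R, 0 < eps -> exists w, open_disc z eps w /\ A w.

(* The supremum is taken in [Rbar] and then projected to [R]; the value is
   meaningful for nonempty bounded sets, the only ones to which it is applied. *)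
Definition diam (A : C -> Prop) : R :=
  real (Lub_Rbar (fun d => exists z w, A z /\ A w /\ d = Cmod (z - w)%C)).

(* [D_*((a,b))] *)
Definition disc_diam (a b : R) : C -> Prop :=
  open_disc (RtoC ((a + b) / 2)) ((b - a) / 2).

(** ** Covering maps between subsets of the plane, for the subspace topologies *)

Definition rel_open (X A : C -> Prop) : Prop :=
  exists O : C -> Prop, open O /\ forall z, A z <-> X z /\ O z.

Definition homeo_between (f : C -> C) (A B : C -> Prop) : Prop :=
  continuous_on A f /\ (forall z, A z -> B (f z)) /\
  exists g : C -> C,
    continuous_on B g /\ (forall w, B w -> A (g w)) /\
    (forall z, A z -> g (f z) = z) /\ (forall w, B w -> f (g w) = w).

Definition evenly_covered (f : C -> C) (X W : C -> Prop) : Prop :=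
  exists (I : Type) (S : I -> C -> Prop),
    (forall i, rel_open X (S i)) /\
    (forall z, X z /\ W (f z) <-> exists i, S i z) /\
    (forall i j z, S i z -> S j z -> i = j) /\
    (forall i, homeo_between f (S i) W).

(* Coverings are required to be onto. *)
Definition covering (f : C -> C) (X Y : C -> Prop) : Prop :=
  continuous_on X f /\
  (forall z, X z -> Y (f z)) /\
  (forall w, Y w -> exists z, X z /\ f z = w) /\
  (forall w, Y w -> exists W, rel_open Y W /\ W w /\ evenly_covered f X W).

Definition holomorphic_on (f : C -> C) (A : C -> Prop) : Prop :=
  forall z, A z -> ex_derive (K := C_AbsRing) (V := C_NormedModule) f z.

(** ** The class F *)

Definition class_F (f : C -> C) (U V : C -> Prop) : Prop :=
  (holomorphic_on f U /\ forall z, U z -> V (f z)) /\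
  (open U /\ Cbounded U /\ closure U (RtoC 0)) /\
  (open V /\ Cbounded V) /\
  covering f (punctured U) (punctured V) /\
  (Csubset (open_disc (RtoC 0) (diam U)) V /\ Csubset U (open_disc (RtoC 0) (diam U))).

(** ** The real family *)

Definition flat_map (l b c x : R) : R :=
  if Req_EM_T x 0 then c else b * exp (- / Rpower (Rabs x) l) + c.

(** ** The complex map [F_0] *)

Definition polar (r t : R) : C := (r * cos t, r * sin t).

Definition Cexp (z : C) : C := polar (exp (Re z)) (Im z).

Definition sector (l : R) : C -> Prop :=
  fun z => exists r t, 0 < r /\ Rabs t < PI / (2 * l) /\ z = polar r t.

(* For [1 <= l] the sector lies in the right half-plane, where the argument of
   [z] is [atan (Im z / Re z)]; see [Phi_polar] below. *)
Definition Phi (l : R) (z : C) : C :=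
  polar (Rpower (Cmod z) l) (l * atan (Im z / Re z)).

Definition Uplus (l x0 : R) : C -> Prop :=
  fun z => sector l z /\ disc_diam 0 (Rpower x0 l) (Phi l z).

Definition Uminus (l x0 : R) : C -> Prop := fun z => Uplus l x0 (- z)%C.

Definition Udom (l x0 : R) : C -> Prop :=
  fun z => Uplus l x0 z \/ Uminus l x0 z.

(* [Uplus] lies in [0 < Re z] and [Uminus] in [Re z < 0], so the sign of [Re z]
   decides which formula applies; values outside [Udom] are irrelevant. *)
Definition F0 (l b : R) (z : C) : C :=
  if Rlt_dec 0 (Re z)
  then (RtoC b * Cexp (- / Phi l z))%C
  else (RtoC b * Cexp (- / Phi l (- z)))%C.

(** ** Kneading sequences *)

Definition unimodal (f : R -> R) : Prop :=
  (forall x y, x < y -> y <= 0 -> f y < f x) /\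
  (forall x y, 0 <= x -> x < y -> f x < f y).

(* Indexed from 0: [kneading f k] is the entry [i_{k+1}], the sign of
   [f^{k+1}(0)].  It is used for unimodal [f] only; see [flat_map_unimodal]. *)
Definition kneading (f : R -> R) (k : nat) : R := sign (Nat.iter (S k) f 0).

(* [prod_f_R0 i n] is the product of the first [n + 1] entries. *)
Definition kneading_lt (i j : nat -> R) : Prop :=
  exists n : nat,
    (forall k, (k < n)%nat -> i k = j k) /\ prod_f_R0 i n < prod_f_R0 j n.

Definition kneading_le (i j : nat -> R) : Prop :=
  (forall k, i k = j k) \/ kneading_lt i j.

(** ** Consistency of the definitions *)

Lemma Phi_polar (l r t : R) :
  0 < r -> Rabs t < PI / 2 -> Phi l (polar r t) = polar (Rpower r l) (l * t).
Proof.
intros hr ht. unfold Phi.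
assert (hc : 0 < cos t).
{ apply Rabs_def2 in ht. apply cos_gt_0; lra. }
replace (Cmod (polar r t)) with r.
2:{ unfold Cmod, polar; simpl.
    replace (_ + _) with (r * r * (Rsqr (sin t) + Rsqr (cos t))).
    - rewrite sin2_cos2, Rmult_1_r. now rewrite sqrt_square; try lra.
    - unfold Rsqr; ring. }
replace (Im (polar r t) / Re (polar r t)) with (tan t).
2:{ unfold tan; simpl. field. lra. }
rewrite atan_tan; [reflexivity|].
apply Rabs_def2 in ht. lra.
Qed.

Lemma F0_real (l b x : R) :
  x <> 0 -> F0 l b (RtoC x) = RtoC (flat_map l b 0 x).
Proof.
assert (key : forall y, 0 < y ->
  (RtoC b * Cexp (- / Phi l (RtoC y)))%C
  = RtoC (b * exp (- / Rpower y l) + 0)).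
{ intros y hy.
  assert (hp : 0 < Rpower y l) by apply exp_pos.
  replace (Phi l (RtoC y)) with (RtoC (Rpower y l)).
  - rewrite <- RtoC_inv by lra. rewrite <- RtoC_opp.
    replace (Cexp (RtoC (- / Rpower y l)))
      with (RtoC (exp (- / Rpower y l))).
    + rewrite <- RtoC_mult. f_equal; ring.
    + unfold Cexp, polar, RtoC; simpl. rewrite cos_0, sin_0. f_equal; ring.
  - unfold Phi. rewrite Cmod_R, Rabs_pos_eq by lra.
    unfold polar, RtoC; simpl.
    replace (0 / y) with 0 by (field; lra).
    rewrite atan_0, Rmult_0_r, cos_0, sin_0. f_equal; ring. }
intros hx. unfold F0, flat_map. destruct (Req_EM_T x 0) as [e|_]; [easy|].
simpl Re. destruct (Rlt_dec 0 x) as [h|h].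
- rewrite key by lra. now rewrite Rabs_pos_eq by lra.
- rewrite <- RtoC_opp. rewrite key by lra. now rewrite Rabs_left by lra.
Qed.

Lemma flat_map_unimodal (l b c : R) :
  0 < l -> 0 < b -> unimodal (flat_map l b c).
Proof.
intros hl hb.
assert (key : forall u v, 0 <= u -> u < v -> flat_map l b c u < flat_map l b c v).
{ intros u v hu huv. unfold flat_map.
  destruct (Req_EM_T v 0) as [e|_]; [lra|].
  destruct (Req_EM_T u 0) as [e|hu0].
  - assert (0 < b * exp (- / Rpower (Rabs v) l)); [|lra].
    apply Rmult_lt_0_compat; [easy|apply exp_pos].
  - apply Rplus_lt_compat_r, Rmult_lt_compat_l; [easy|].
    apply exp_increasing, Ropp_lt_contravar.
    rewrite !Rabs_pos_eq by lra.
    apply Rinv_lt_contravar.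
    + apply Rmult_lt_0_compat; apply exp_pos.
    + apply Rlt_Rpower_l; lra. }
assert (even : forall u, flat_map l b c (- u) = flat_map l b c u).
{ intros u. unfold flat_map. rewrite Rabs_Ropp.
  destruct (Req_EM_T u 0), (Req_EM_T (- u) 0); try easy; exfalso; lra. }
split; intros x y h1 h2.
- rewrite <- (even x), <- (even y). apply key; lra.
- now apply key.
Qed.

(* Main.v *)
(* The covering: on the sector side, 1/Phi is a conformal map onto the half-plane
   Re > x0^-l, and F_0 is w |-> b exp(-w) after it; so its sheets over a half-disc
   are indexed by the branches of the logarithm and by the two components of U.

   Monotonicity: it suffices that whenever f_c^q(0) = 0 (q minimal), the derivative
   of c |-> f_c^q(0) has the sign of Df_c^(q-1)(c).  Put p_j = f_c^(j+1)(0).  Both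
   numbers are values, at lam = 1 and lam -> oo, of v_(q-1), where v_0 = 1 and
   v_(j+1) = 1 + lam f_c'(p_j) v_j; so one shows v_(q-1) <> 0 for lam >= 1.
   If it vanishes, consider holomorphic motions z_j(t) of the p_j in U, and lift
   them: f_0(z'_j) = H_t(z_(j+1) - z_0), with H_t(u) = u + t h(u).  The lift exists
   on the whole domain of t because differences of points of U are at most diam(U) < R,
   so H_t, for small t, sends them into V minus 0, and injectively; the slack in
   diam(U) < R is what allows h.  If h interpolates h(p_(j+1) - p_0) = f_c'(p_j) v_j,
   initial velocities s v lift to (lam s + 1) v.  Starting from the constant motion,
   the velocities tend to infinity, which contradicts Cauchy's estimate. *)

(* The perturbation [h] is forced by [lam = 1], the very value that decides transversality. Lifting
   a motion without [h] acts linearly on velocities, and the nonzero eigenvalues of this operator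
   are the zeros of [v_(q-1)] as a polynomial in [lam]. An eigenvalue above 1 would make iterated
   lifts grow, but at 1 they merely reproduce [v] and nothing is contradicted. The term [t h(u)]
   adds a fresh copy of [v] at each lift, so after [n] lifts the factor is at least [n]; neither [h]
   nor the bound on [t] depends on [n]. The condition [c >= -beta] confines a critical orbit that
   returns to 0 to [[-beta, beta]], inside the range where the motions live. From transversality to
   monotonicity: the products [i_1 ... i_k], weighted by powers of 1/2, give a step function of [c].
   Near a parameter its terms are constant up to the first place where the critical orbit hits 0;
   there the product passes through -1, 0, 1, and at the parameter itself all later products are 0.
   So every value lies between the nearby values to its left and right, and a supremum argument
   concludes, however the parameters of vanishing may be distributed. *)
Require Import Defs.
From Stdlib Require Import Reals Lra Lia Arith ZArith Classical ClassicalEpsilon.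
From Coquelicot Require Import Coquelicot.
Open Scope R_scope.

(** * Continuity of complex-valued maps *)

(* [ring] and [field] do not see through the sort of [C_UniformSpace]. *)
Ltac Ceq :=
  repeat match goal with w : UniformSpace.sort C_UniformSpace |- _ => change C in w end;
  match goal with |- @eq _ ?a ?b => change (@eq C a b) end.
Ltac Cring := Ceq; ring.
Ltac Cfield := Ceq; field.

Notation Ccont T := (@continuous T C_UniformSpace).

Lemma C_ext (z w : C) : Re z = Re w -> Im z = Im w -> z = w.
Proof. destruct z, w; simpl; intros; subst; reflexivity. Qed.

(** The basic neighbourhoods are squares; the sup norm and the modulus differ by a factor of at most
    [sqrt 2], so discs generate the same filter. *)
Lemma locally_Cmod (z : C) (P : C -> Prop) :
  @locally C_UniformSpace z P <->
  exists d, 0 < d /\ forall w, Cmod (w - z)%C < d -> P w.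
Proof.
split.
- intros [e He]. exists e. split; [apply cond_pos|].
  intros w Hw. apply He. apply C_NormedModule_mixin_compat1. exact Hw.
- intros [d [Hd H]].
  assert (H2 : 0 < sqrt 2) by (apply sqrt_lt_R0; lra).
  assert (He : 0 < d / sqrt 2) by (apply Rdiv_lt_0_compat; lra).
  exists (mkposreal _ He). intros w Hw. apply H.
  apply C_NormedModule_mixin_compat2 in Hw. simpl in Hw.
  replace (sqrt 2 * (d / sqrt 2)) with d in Hw by (field; lra). exact Hw.
Qed.

Lemma open_Cmod (A : C -> Prop) :
  @open C_UniformSpace A <->
  forall z, A z -> exists d, 0 < d /\ forall w, Cmod (w - z)%C < d -> A w.
Proof.
split; intros H z Hz; apply locally_Cmod, H, Hz.
Qed.

Section Continuity.
Context {T : UniformSpace}.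

Lemma continuous_Cpair (f g : T -> R) (x : T) :
  continuous f x -> continuous g x -> Ccont T (fun t => (f t, g t)) x.
Proof.
intros Hf Hg. unfold continuous. apply filterlim_locally. intros eps.
unfold continuous in Hf, Hg.
pose proof (proj1 (filterlim_locally _ _) Hf eps) as H1.
pose proof (proj1 (filterlim_locally _ _) Hg eps) as H2.
generalize (filter_and _ _ H1 H2). apply filter_imp.
intros t [A B]. split; assumption.
Qed.

Lemma continuous_Rplus (f g : T -> R) (x : T) :
  continuous f x -> continuous g x -> continuous (fun t => f t + g t) x.
Proof. exact (continuous_plus (V := R_NormedModule) f g x). Qed.

Lemma continuous_Ropp (f : T -> R) (x : T) :
  continuous f x -> continuous (fun t => - f t) x.
Proof. exact (continuous_opp (V := R_NormedModule) f x). Qed.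

Lemma continuous_Rmult (f g : T -> R) (x : T) :
  continuous f x -> continuous g x -> continuous (fun t => f t * g t) x.
Proof. exact (continuous_mult (K := R_AbsRing) f g x). Qed.

Lemma continuous_Rcomp (g : R -> R) (f : T -> R) (x : T) :
  continuous f x -> continuity_pt g (f x) -> continuous (fun t => g (f t)) x.
Proof.
intros Hf Hg. apply (continuous_comp f g); [exact Hf|].
now apply continuity_pt_filterlim.
Qed.

Lemma continuous_Rinv_fun (f : T -> R) (x : T) :
  continuous f x -> f x <> 0 -> continuous (fun t => / f t) x.
Proof.
intros Hf H. apply (continuous_Rcomp Rinv); [exact Hf|].
apply continuity_pt_inv; [|exact H]. apply derivable_continuous_pt, derivable_pt_id.
Qed.

Lemma continuous_Re (f : T -> C) (x : T) :
  Ccont T f x -> continuous (fun t => Re (f t)) x.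
Proof. intros H. apply (continuous_comp f (fun z : C => fst z)); [exact H|]. apply continuous_fst. Qed.

Lemma continuous_Im (f : T -> C) (x : T) :
  Ccont T f x -> continuous (fun t => Im (f t)) x.
Proof. intros H. apply (continuous_comp f (fun z : C => snd z)); [exact H|]. apply continuous_snd. Qed.

Lemma continuous_sqnorm (f : T -> C) (x : T) :
  Ccont T f x -> continuous (fun t => Re (f t) ^ 2 + Im (f t) ^ 2) x.
Proof.
intros Hf.
pose proof (continuous_Re f x Hf) as Hr. pose proof (continuous_Im f x Hf) as Hi.
apply continuous_ext with (fun t => Re (f t) * Re (f t) + Im (f t) * Im (f t)).
{ intros t. simpl; ring. }
apply continuous_Rplus; now apply continuous_Rmult.
Qed.

Lemma continuous_Cplus (f g : T -> C) (x : T) :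
  Ccont T f x -> Ccont T g x -> Ccont T (fun t => f t + g t)%C x.
Proof.
intros Hf Hg. apply continuous_Cpair.
- apply continuous_Rplus; now apply continuous_Re.
- apply continuous_Rplus; now apply continuous_Im.
Qed.

Lemma continuous_Copp (f : T -> C) (x : T) :
  Ccont T f x -> Ccont T (fun t => - f t)%C x.
Proof.
intros Hf. apply continuous_Cpair; apply continuous_Ropp.
- now apply continuous_Re.
- now apply continuous_Im.
Qed.

Lemma continuous_Cminus (f g : T -> C) (x : T) :
  Ccont T f x -> Ccont T g x -> Ccont T (fun t => f t - g t)%C x.
Proof. intros. apply continuous_Cplus; [|apply continuous_Copp]; assumption. Qed.

Lemma continuous_Cmult (f g : T -> C) (x : T) :
  Ccont T f x -> Ccont T g x -> Ccont T (fun t => f t * g t)%C x.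
Proof.
intros Hf Hg.
pose proof (continuous_Re f x Hf). pose proof (continuous_Im f x Hf).
pose proof (continuous_Re g x Hg). pose proof (continuous_Im g x Hg).
apply continuous_Cpair; apply continuous_Rplus; try apply continuous_Ropp;
  now apply continuous_Rmult.
Qed.

Lemma continuous_Cinv (f : T -> C) (x : T) :
  Ccont T f x -> f x <> RtoC 0 -> Ccont T (fun t => / f t)%C x.
Proof.
intros Hf H.
assert (Hn : Re (f x) ^ 2 + Im (f x) ^ 2 <> 0).
{ intros E. apply H. apply C_ext; simpl; nra. }
pose proof (continuous_Rinv_fun _ x (continuous_sqnorm f x Hf) Hn) as Hc.
apply continuous_Cpair; apply continuous_Rmult; try exact Hc.
- now apply continuous_Re.
- apply continuous_Ropp. now apply continuous_Im.
Qed.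

Lemma continuous_Cmod_fun (f : T -> C) (x : T) :
  Ccont T f x -> continuous (fun t => Cmod (f t)) x.
Proof.
intros Hf. apply (continuous_comp (fun t => Re (f t) ^ 2 + Im (f t) ^ 2) sqrt).
- now apply continuous_sqnorm.
- apply continuous_sqrt.
Qed.

Lemma continuous_Cexp_fun (f : T -> C) (x : T) :
  Ccont T f x -> Ccont T (fun t => Cexp (f t)) x.
Proof.
intros Hf.
pose proof (continuous_Re f x Hf) as Hr. pose proof (continuous_Im f x Hf) as Hi.
assert (He : continuous (fun t => exp (Re (f t))) x).
{ apply (continuous_Rcomp exp); [exact Hr|]. apply derivable_continuous_pt, derivable_pt_exp. }
apply continuous_Cpair; apply continuous_Rmult; try exact He.
- apply (continuous_Rcomp cos); [exact Hi|]. apply continuity_cos.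
- apply (continuous_Rcomp sin); [exact Hi|]. apply continuity_sin.
Qed.

End Continuity.

(** * Exponential and logarithm *)

Lemma Cexp_plus (z w : C) : Cexp (z + w) = (Cexp z * Cexp w)%C.
Proof.
destruct z as [a a'], w as [c c']. unfold Cexp, polar, Cplus, Cmult; simpl.
rewrite exp_plus, cos_plus, sin_plus. f_equal; ring.
Qed.

Lemma Cmod_Cexp (z : C) : Cmod (Cexp z) = exp (Re z).
Proof.
unfold Cmod, Cexp, polar; simpl.
replace (_ + _) with (exp (Re z) * exp (Re z) * (Rsqr (sin (Im z)) + Rsqr (cos (Im z)))).
- rewrite sin2_cos2, Rmult_1_r. apply sqrt_square. left; apply exp_pos.
- unfold Rsqr; ring.
Qed.

Lemma Cexp_neq0 (z : C) : Cexp z <> RtoC 0.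
Proof. apply Cmod_gt_0. rewrite Cmod_Cexp. apply exp_pos. Qed.

Lemma Cexp_R (x : R) : Cexp (RtoC x) = RtoC (exp x).
Proof. unfold Cexp, polar; simpl. rewrite cos_0, sin_0. apply C_ext; simpl; ring. Qed.

Lemma Cexp_opp (z : C) : Cexp (- z) = (/ Cexp z)%C.
Proof.
assert (H : (Cexp z * Cexp (- z))%C = RtoC 1).
{ rewrite <- Cexp_plus. replace (z + - z)%C with (RtoC 0) by ring.
  rewrite Cexp_R, exp_0. reflexivity. }
pose proof (Cexp_neq0 z) as Hz.
replace (Cexp (- z)) with (/ Cexp z * (Cexp z * Cexp (- z)))%C by (field; exact Hz).
rewrite H. ring.
Qed.

(** The principal logarithm, but only on [0 < Re z]: for [Re z < 0] the [atan] formula misses the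
    argument by [PI]. The imaginary part is nevertheless below [PI / 2] in modulus for every [z]. *)
Definition Clog (z : C) : C := (ln (Cmod z), atan (Im z / Re z)).

Lemma Re_pos_neq0 (z : C) : 0 < Re z -> z <> RtoC 0.
Proof. intros H E. rewrite E in H. simpl in H. lra. Qed.

Lemma Cexp_Clog (z : C) : 0 < Re z -> Cexp (Clog z) = z.
Proof.
intros H. pose proof (Re_pos_neq0 z H) as Hz. apply Cmod_gt_0 in Hz.
unfold Cexp, Clog, polar; simpl. rewrite exp_ln by exact Hz.
rewrite cos_atan, sin_atan.
assert (E : sqrt (1 + (Im z / Re z)²) = Cmod z / Re z).
{ replace (1 + (Im z / Re z)²) with ((Re z ^ 2 + Im z ^ 2) / (Re z)²)
    by (unfold Rsqr; field; lra).
  rewrite sqrt_div_alt by (unfold Rsqr; nra). rewrite sqrt_Rsqr by lra. reflexivity. }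
rewrite E. apply C_ext; simpl; field; lra.
Qed.

Lemma Im_Clog_bound (z : C) : Rabs (Im (Clog z)) < PI / 2.
Proof.
unfold Clog; simpl. destruct (atan_bound (Im z / Re z)). apply Rabs_def1; lra.
Qed.

Lemma Clog_Cexp (z : C) : Rabs (Im z) < PI / 2 -> Clog (Cexp z) = z.
Proof.
intros H. apply Rabs_def2 in H.
assert (hc : 0 < cos (Im z)) by (apply cos_gt_0; lra).
unfold Clog. rewrite Cmod_Cexp, ln_exp.
replace (Im (Cexp z) / Re (Cexp z)) with (tan (Im z)).
- rewrite atan_tan by lra. apply C_ext; reflexivity.
- unfold tan, Cexp, polar; simpl. field. pose proof (exp_pos (Re z)). lra.
Qed.

Lemma Re_Cexp_pos (z : C) : Rabs (Im z) < PI / 2 -> 0 < Re (Cexp z).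
Proof.
intros H. apply Rabs_def2 in H. unfold Cexp, polar; simpl.
apply Rmult_lt_0_compat; [apply exp_pos|apply cos_gt_0; lra].
Qed.

Lemma Clog_R (x : R) : 0 < x -> Clog (RtoC x) = RtoC (ln x).
Proof.
intros H. unfold Clog. rewrite Cmod_R, Rabs_pos_eq by lra. simpl.
replace (0 / x) with 0 by (field; lra). rewrite atan_0. reflexivity.
Qed.

Lemma continuous_Clog_fun {T : UniformSpace} (f : T -> C) (x : T) :
  Ccont T f x -> 0 < Re (f x) -> Ccont T (fun t => Clog (f t)) x.
Proof.
intros Hf H. apply continuous_Cpair.
- apply (continuous_Rcomp ln); [now apply continuous_Cmod_fun|].
  apply derivable_continuous_pt. exists (/ Cmod (f x)). apply derivable_pt_lim_ln.
  apply Cmod_gt_0, Re_pos_neq0, H.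
- apply (continuous_Rcomp atan).
  + apply continuous_Rmult; [now apply continuous_Im|].
    apply continuous_Rinv_fun; [now apply continuous_Re|lra].
  + apply derivable_continuous_pt, derivable_pt_atan.
Qed.

Definition two_pi_i (k : Z) : C := (0, 2 * PI * IZR k).

Lemma Cexp_eq1 (z : C) : Cexp z = RtoC 1 -> exists k : Z, z = two_pi_i k.
Proof.
intros H. assert (Hr : Re z = 0).
{ assert (E : Cmod (Cexp z) = 1) by (rewrite H; apply Cmod_1).
  rewrite Cmod_Cexp in E. rewrite <- (ln_exp (Re z)), E. apply ln_1. }
assert (Hc : cos (Im z) = 1).
{ apply (f_equal Re) in H. unfold Cexp, polar in H; simpl in H.
  rewrite Hr, exp_0 in H. lra. }
(* Half-angle formula: [cos y = 1 - 2 sin^2 (y/2)], so [cos y = 1] puts [y/2] at a zero of the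
   sine. *)
assert (Hs : sin (Im z / 2) = 0).
{ replace (Im z) with (2 * (Im z / 2)) in Hc by field.
  rewrite cos_2a_sin in Hc. nra. }
destruct (sin_eq_0_0 _ Hs) as [k Hk]. exists k.
apply C_ext; simpl; lra.
Qed.

Lemma Cexp_eq (z w : C) :
  Cexp z = Cexp w -> exists k : Z, z = (w + two_pi_i k)%C.
Proof.
intros H. destruct (Cexp_eq1 (z - w)) as [k Hk].
- unfold Cminus. rewrite Cexp_plus, Cexp_opp, H. field. apply Cexp_neq0.
- exists k. rewrite <- Hk. ring.
Qed.

Lemma Cexp_period (z : C) (k : Z) : Cexp (z + two_pi_i k) = Cexp z.
Proof.
rewrite Cexp_plus. replace (Cexp (two_pi_i k)) with (RtoC 1); [ring|].
unfold Cexp, polar; simpl. rewrite exp_0.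
replace (2 * PI * IZR k) with (2 * (IZR k * PI)) by ring.
rewrite cos_2a_sin, sin_2a.
rewrite (sin_eq_0_1 (IZR k * PI)) by (exists k; reflexivity).
apply C_ext; simpl; ring.
Qed.

(** * Complex derivatives *)

(* Caratheodory's form of the derivative. *)
Definition cder (f : C -> C) (z d : C) : Prop :=
  exists phi : C -> C, Ccont C_UniformSpace phi z /\ phi z = d /\
    @locally C_UniformSpace z (fun w => f w = (f z + phi w * (w - z))%C).

Lemma cder_continuous (f : C -> C) (z d : C) :
  cder f z d -> Ccont C_UniformSpace f z.
Proof.
intros (phi & Hc & Hd & H).
apply continuous_ext_loc with (fun w => f z + phi w * (w - z))%C.
- revert H. apply filter_imp. intros w ->. reflexivity.
- apply continuous_Cplus; [apply continuous_const|].
  apply continuous_Cmult; [exact Hc|].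
  apply continuous_Cminus; [apply continuous_id|apply continuous_const].
Qed.

Lemma cder_ext_loc (f g : C -> C) (z d : C) :
  @locally C_UniformSpace z (fun w => f w = g w) -> cder f z d -> cder g z d.
Proof.
intros He (phi & Hc & Hd & H). exists phi; repeat split; try assumption.
assert (E : f z = g z) by exact (locally_singleton _ _ He).
generalize (filter_and _ _ He H). apply filter_imp.
intros w [A B]. rewrite <- E, <- A. exact B.
Qed.

Lemma cder_const (a z : C) : cder (fun _ => a) z (RtoC 0).
Proof.
exists (fun _ => RtoC 0). split; [apply continuous_const|]. split; [reflexivity|].
apply filter_forall. intros w. Cring.
Qed.

Lemma cder_id (z : C) : cder (fun w => w) z (RtoC 1).
Proof.
exists (fun _ => RtoC 1). split; [apply continuous_const|]. split; [reflexivity|].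
apply filter_forall. intros w. Cring.
Qed.

Lemma cder_plus (f g : C -> C) (z a b : C) :
  cder f z a -> cder g z b -> cder (fun w => f w + g w)%C z (a + b)%C.
Proof.
intros (p & Hp & Ha & Hf) (q & Hq & Hb & Hg).
exists (fun w => p w + q w)%C. split; [now apply continuous_Cplus|].
split; [now rewrite Ha, Hb|].
generalize (filter_and _ _ Hf Hg). apply filter_imp. intros w [-> ->]. Cring.
Qed.

Lemma cder_mult (f g : C -> C) (z a b : C) :
  cder f z a -> cder g z b -> cder (fun w => f w * g w)%C z (a * g z + f z * b)%C.
Proof.
intros Df Dg. pose proof (cder_continuous g z b Dg) as Hcg.
destruct Df as (p & Hp & Ha & Hf). destruct Dg as (q & Hq & Hb & Hg).
exists (fun w => p w * g w + f z * q w)%C. split.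
{ apply continuous_Cplus; apply continuous_Cmult; try assumption. apply continuous_const. }
split; [now rewrite Ha, Hb|].
generalize (filter_and _ _ Hf Hg). apply filter_imp. intros w [-> E].
replace (g w) with (g z + q w * (w - z))%C by (symmetry; exact E). Cring.
Qed.

Lemma cder_scal (f : C -> C) (k z a : C) :
  cder f z a -> cder (fun w => k * f w)%C z (k * a)%C.
Proof.
intros H. replace (k * a)%C with (RtoC 0 * f z + k * a)%C by Cring.
apply (cder_mult (fun _ => k)); [apply cder_const|exact H].
Qed.

Lemma cder_opp (f : C -> C) (z a : C) :
  cder f z a -> cder (fun w => - f w)%C z (- a)%C.
Proof.
intros (p & Hp & Ha & Hf). exists (fun w => - p w)%C.
split; [now apply continuous_Copp|]. split; [now rewrite Ha|].
revert Hf. apply filter_imp. intros w ->. Cring.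
Qed.

Lemma cder_minus (f g : C -> C) (z a b : C) :
  cder f z a -> cder g z b -> cder (fun w => f w - g w)%C z (a - b)%C.
Proof. intros. apply cder_plus; [|apply cder_opp]; assumption. Qed.

(** The slope function of the composite is [p (g w) * q w]; slope functions are never quotients
    here, so the case [g w = g z] needs no separate treatment. *)
Lemma cder_comp (f g : C -> C) (z a b : C) :
  cder f (g z) a -> cder g z b -> cder (fun w => f (g w)) z (a * b)%C.
Proof.
intros (p & Hp & Ha & Hf) Dg. pose proof (cder_continuous g z b Dg) as Hcg.
destruct Dg as (q & Hq & Hb & Hg).
exists (fun w => p (g w) * q w)%C. split.
{ apply continuous_Cmult; [|exact Hq].
  apply (continuous_comp (U:=C_UniformSpace) (V:=C_UniformSpace) g p z Hcg Hp). }
split; [now rewrite Ha, Hb|].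
assert (Hl : @locally C_UniformSpace z
  (fun w => f (g w) = (f (g z) + p (g w) * (g w - g z))%C)) by exact (Hcg _ Hf).
generalize (filter_and _ _ Hl Hg). apply filter_imp. intros w [E1 E2].
rewrite E1. replace (g w - g z)%C with (q w * (w - z))%C by (rewrite E2; Cring). Cring.
Qed.

Lemma cder_inv_id (z : C) : z <> RtoC 0 -> cder (fun w => / w)%C z (- / (z * z))%C.
Proof.
intros Hz. exists (fun w => - / (w * z))%C. split.
{ apply continuous_Copp, continuous_Cinv.
  - apply continuous_Cmult; [apply continuous_id|apply continuous_const].
  - now apply Cmult_neq_0. }
split; [reflexivity|].
apply locally_Cmod. exists (Cmod z). split; [now apply Cmod_gt_0|].
intros w Hw. assert (w <> RtoC 0).
{ intros ->. replace (0 - z)%C with (- z)%C in Hw by Cring. rewrite Cmod_opp in Hw. lra. }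
Cfield. tauto.
Qed.

Lemma cder_inv (f : C -> C) (z a : C) :
  cder f z a -> f z <> RtoC 0 -> cder (fun w => / f w)%C z (- (a / (f z * f z)))%C.
Proof.
intros H Hz. replace (- (a / (f z * f z)))%C with (- / (f z * f z) * a)%C.
- apply (cder_comp (fun w => / w)%C); [now apply cder_inv_id|exact H].
- unfold Cdiv. Cring.
Qed.

Lemma Cmod_le_abs (z : C) : Cmod z <= Rabs (Re z) + Rabs (Im z).
Proof.
replace z with (RtoC (Re z) + Ci * RtoC (Im z))%C at 1.
- eapply Rle_trans; [apply Cmod_triangle|].
  rewrite Cmod_mult, Cmod_Ci, !Cmod_R. lra.
- apply C_ext; simpl; ring.
Qed.

Lemma Im_le_Cmod (z : C) : Rabs (Im z) <= Cmod z.
Proof.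
eapply Rle_trans; [|apply Rmax_Cmod]. apply Rmax_r.
Qed.

Lemma derivable_pt_lim_0_bound (f : R -> R) (d eps : R) :
  derivable_pt_lim f 0 d -> 0 < eps ->
  exists del, 0 < del /\ forall h, Rabs h < del -> Rabs (f h - f 0 - d * h) <= eps * Rabs h.
Proof.
intros H He. destruct (H eps He) as [del Hd]. exists del. split; [apply cond_pos|].
intros h Hh. destruct (Req_EM_T h 0) as [->|Hn].
- rewrite Rmult_0_r, Rabs_R0. replace (f 0 - f 0 - 0) with 0 by ring. rewrite Rabs_R0. lra.
- specialize (Hd h Hn Hh). rewrite Rplus_0_l in Hd.
  replace (f h - f 0 - d * h) with (((f h - f 0) / h - d) * h) by (field; exact Hn).
  rewrite Rabs_mult. apply Rmult_le_compat_r; [apply Rabs_pos|lra].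
Qed.

(** With [h = x + i y] and [a], [s], [c] the first-order remainders of [exp x], [sin y], [cos y],
    the remainder of [Cexp] has real part [a + exp x * c] and imaginary part
    [exp x * s + (exp x - 1) * y]. *)
Lemma Cexp_first_order (eps : R) : 0 < eps ->
  exists del, 0 < del /\
    forall h, Cmod h < del -> Cmod (Cexp h - 1 - h)%C <= eps * Cmod h.
Proof.
(* Each of the two parts will be at most [3 e |h|], so [eps / 8] is ample; the cap [1 / 2] ensures
   [exp x <= 2]. *)
intros He0. set (e := Rmin (eps / 8) (1 / 2)).
assert (He : 0 < e) by (unfold e; apply Rmin_glb_lt; lra).
assert (He1 : e <= eps / 8) by apply Rmin_l.
assert (He2 : e <= 1 / 2) by apply Rmin_r.
destruct (derivable_pt_lim_0_bound exp 1 e derivable_pt_lim_exp_0 He) as (d1 & P1 & B1).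
destruct (derivable_pt_lim_0_bound sin 1 e) as (d2 & P2 & B2); [|exact He|].
{ rewrite <- cos_0. apply derivable_pt_lim_sin. }
destruct (derivable_pt_lim_0_bound cos 0 e) as (d3 & P3 & B3); [|exact He|].
{ replace 0 with (- sin 0) at 2 by (rewrite sin_0; ring). apply derivable_pt_lim_cos. }
exists (Rmin (Rmin d1 d2) (Rmin d3 (e / 2))). split.
{ repeat apply Rmin_glb_lt; lra. }
intros h Hh.
assert (H1 : Cmod h < d1) by (eapply Rlt_le_trans; [exact Hh|]; eapply Rle_trans; [apply Rmin_l|apply Rmin_l]).
assert (H2 : Cmod h < d2) by (eapply Rlt_le_trans; [exact Hh|]; eapply Rle_trans; [apply Rmin_l|apply Rmin_r]).
assert (H3 : Cmod h < d3) by (eapply Rlt_le_trans; [exact Hh|]; eapply Rle_trans; [apply Rmin_r|apply Rmin_l]).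
assert (H4 : Cmod h < e / 2) by (eapply Rlt_le_trans; [exact Hh|]; eapply Rle_trans; [apply Rmin_r|apply Rmin_r]).
set (x := Re h). set (y := Im h).
assert (Hx : Rabs x <= Cmod h) by apply re_le_Cmod.
assert (Hy : Rabs y <= Cmod h) by apply Im_le_Cmod.
specialize (B1 x ltac:(lra)). specialize (B2 y ltac:(lra)). specialize (B3 y ltac:(lra)).
rewrite exp_0 in B1. rewrite sin_0 in B2. rewrite cos_0 in B3.
pose proof (Rabs_pos x). pose proof (Rabs_pos y).
set (a := exp x - 1 - 1 * x) in *. set (s := sin y - 0 - 1 * y) in *.
set (c := cos y - 1 - 0 * y) in *.
assert (E1 : exp x = 1 + x + a) by (unfold a; ring).
assert (Hex : Rabs (exp x - 1) <= e).
{ replace (exp x - 1) with (x + a) by (rewrite E1; ring).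
  eapply Rle_trans; [apply Rabs_triang|]. nra. }
assert (Hex2 : Rabs (exp x) <= 2).
{ replace (exp x) with (1 + (exp x - 1)) by ring.
  eapply Rle_trans; [apply Rabs_triang|]. rewrite Rabs_R1. lra. }
eapply Rle_trans; [apply Cmod_le_abs|].
replace (Re (Cexp h - 1 - h)) with (a + exp x * c)
  by (unfold Cexp, polar, a, c, x, y; unfold Re, Im; simpl; ring).
replace (Im (Cexp h - 1 - h)) with (exp x * s + (exp x - 1) * y)
  by (unfold Cexp, polar, s, x, y, Re, Im; simpl; ring).
assert (T1 : Rabs (a + exp x * c) <= 3 * e * Cmod h).
{ eapply Rle_trans; [apply Rabs_triang|]. rewrite Rabs_mult.
  assert (Rabs (exp x) * Rabs c <= 2 * (e * Cmod h)).
  { apply Rmult_le_compat; try apply Rabs_pos; try assumption. nra. }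
  nra. }
assert (T2 : Rabs (exp x * s + (exp x - 1) * y) <= 3 * e * Cmod h).
{ eapply Rle_trans; [apply Rabs_triang|]. rewrite !Rabs_mult.
  assert (Rabs (exp x) * Rabs s <= 2 * (e * Cmod h)).
  { apply Rmult_le_compat; try apply Rabs_pos; try assumption. nra. }
  assert (Rabs (exp x - 1) * Rabs y <= e * Cmod h).
  { apply Rmult_le_compat; try apply Rabs_pos; assumption. }
  nra. }
pose proof (Cmod_ge_0 h). nra.
Qed.

(** By [Cexp w = Cexp z * Cexp (w - z)] the difference quotient at [z] is [Cexp z] times the one at
    0, which [Cexp_first_order] controls. *)
Lemma cder_Cexp (z : C) : cder Cexp z (Cexp z).
Proof.
set (phi := fun w : C => match excluded_middle_informative (w = z) with
  | left _ => Cexp z | right _ => ((Cexp w - Cexp z) / (w - z))%C end).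
exists phi.
assert (Ez : phi z = Cexp z).
{ unfold phi. destruct (excluded_middle_informative (z = z)); [reflexivity|tauto]. }
split; [|split; [exact Ez|]].
- unfold continuous. rewrite Ez. intros P HP. apply locally_Cmod in HP.
  destruct HP as (e & He & HP). unfold filtermap. apply locally_Cmod.
  assert (Hm : 0 < Cmod (Cexp z)) by (apply Cmod_gt_0, Cexp_neq0).
  destruct (Cexp_first_order (e / (2 * Cmod (Cexp z)))) as (d & Hd & B).
  { apply Rdiv_lt_0_compat; lra. }
  exists d. split; [exact Hd|]. intros w Hw. apply HP. unfold phi.
  destruct (excluded_middle_informative (w = z)) as [_|n].
  + replace (Cexp z - Cexp z)%C with (RtoC 0) by Cring. rewrite Cmod_0. exact He.
  + assert (Hn : (w - z)%C <> RtoC 0).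
    { intros E. apply n. replace w with (w - z + z)%C by Cring. rewrite E. Cring. }
    pose proof (proj1 (Cmod_gt_0 _) Hn) as Hp.
    specialize (B _ Hw).
    replace (Cexp w) with (Cexp z * Cexp (w - z))%C
      by (rewrite <- Cexp_plus; f_equal; Cring).
    replace ((Cexp z * Cexp (w - z) - Cexp z) / (w - z) - Cexp z)%C
      with (Cexp z * (Cexp (w - z) - 1 - (w - z)) / (w - z))%C by (Cfield; exact Hn).
    rewrite Cmod_div, Cmod_mult by exact Hn.
    apply Rle_lt_trans with (Cmod (Cexp z) * (e / (2 * Cmod (Cexp z)) * Cmod (w - z)) / Cmod (w - z)).
    * apply Rmult_le_compat_r; [left; now apply Rinv_0_lt_compat|].
      apply Rmult_le_compat_l; [lra|exact B].
    * replace (_ / _) with (e / 2) by (field; lra). lra.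
- apply filter_forall. intros w; change C in w. unfold phi.
  destruct (excluded_middle_informative (w = z)) as [->|n]; [Cring|].
  cbv beta. Cfield. intros E. apply n. replace w with (w - z + z)%C by Cring. rewrite E. Cring.
Qed.

(** The inverse function rule for slopes: if [p] is a slope function of [Cexp] at [Clog z], then
    [/ p (Clog w)] is one for [Clog], since [p (Clog w)] stays nonzero near [z]. *)
Lemma cder_Clog (z : C) : 0 < Re z -> cder Clog z (/ z)%C.
Proof.
intros Hz. destruct (cder_Cexp (Clog z)) as (p & Hp & Ep & H).
rewrite Cexp_Clog in Ep by exact Hz.
assert (Hc : Ccont C_UniformSpace Clog z).
{ apply (continuous_Clog_fun (fun w : C_UniformSpace => w)); [apply continuous_id|exact Hz]. }
assert (Hpc : Ccont C_UniformSpace (fun w => p (Clog w)) z)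
  by exact (continuous_comp (U:=C_UniformSpace) (V:=C_UniformSpace) Clog p z Hc Hp).
assert (Hz0 : p (Clog z) <> RtoC 0) by (rewrite Ep; now apply Re_pos_neq0).
exists (fun w => / p (Clog w))%C. split; [now apply continuous_Cinv|].
split; [now rewrite Ep|].
assert (L1 : @locally C_UniformSpace z (fun w => 0 < Re w)).
{ apply (continuous_Re (fun w : C_UniformSpace => w) z (continuous_id z) (fun x => 0 < x)).
  apply (open_gt 0 (Re z)). exact Hz. }
assert (L2 : @locally C_UniformSpace z (fun w => 0 < Cmod (p (Clog w)))).
{ apply (continuous_Cmod_fun _ z Hpc (fun x => 0 < x)).
  apply (open_gt 0). now apply Cmod_gt_0. }
assert (L3 : @locally C_UniformSpace z (fun w =>
  Cexp (Clog w) = (Cexp (Clog z) + p (Clog w) * (Clog w - Clog z))%C)) by exact (Hc _ H).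
generalize (filter_and _ _ (filter_and _ _ L1 L2) L3). apply filter_imp.
intros w [[A B] E]. apply Cmod_gt_0 in B. rewrite !Cexp_Clog in E by assumption.
change C in w. replace (w - z)%C with (z + p (Clog w) * (Clog w - Clog z) - z)%C
  by (rewrite <- E; reflexivity).
field. exact B.
Qed.

Lemma cder_unique (f : C -> C) (z a b : C) : cder f z a -> cder f z b -> a = b.
Proof.
intros (p & Hp & Ea & Hf) (q & Hq & Eb & Hg).
apply NNPP. intros n.
assert (Hc : Ccont C_UniformSpace (fun w => p w - q w)%C z) by now apply continuous_Cminus.
assert (Hd : 0 < Cmod (p z - q z)).
{ apply Cmod_gt_0. rewrite Ea, Eb. intros E. apply n.
  replace a with (a - b + b)%C by Cring. rewrite E. Cring. }
assert (L : @locally C_UniformSpace z (fun w => 0 < Cmod (p w - q w))).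
{ apply (continuous_Cmod_fun _ z Hc (fun x => 0 < x)). now apply (open_gt 0). }
pose proof (filter_and _ _ L (filter_and _ _ Hf Hg)) as HL.
apply locally_Cmod in HL. destruct HL as (d & Hd0 & HL).
destruct (HL (z + RtoC (d / 2))%C) as (A & B & B').
{ replace (z + RtoC (d / 2) - z)%C with (RtoC (d / 2)) by Cring.
  rewrite Cmod_R, Rabs_pos_eq; lra. }
set (w := (z + RtoC (d / 2))%C) in *.
assert (Ew : (w - z)%C = RtoC (d / 2)) by (unfold w; Cring).
rewrite B in B'. rewrite Ew in B'.
assert (E : ((p w - q w) * RtoC (d / 2))%C = RtoC 0).
{ replace ((p w - q w) * RtoC (d / 2))%C
    with ((f z + p w * RtoC (d / 2)) - (f z + q w * RtoC (d / 2)))%C by Cring.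
  rewrite B'. Cring. }
revert E. apply Cmult_neq_0.
- now apply Cmod_gt_0.
- intros E. apply (f_equal Re) in E. simpl in E. lra.
Qed.

Lemma cder_is_derive (f : C -> C) (z d : C) :
  cder f z d -> is_derive (K := C_AbsRing) (V := C_NormedModule) f z d.
Proof.
intros (p & Hp & Ep & H). split.
- apply (is_linear_scal_l (K := C_AbsRing) (V := C_NormedModule)).
- intros x Hx eps.
  assert (Exz : z = x).
  { apply (is_filter_lim_locally_unique (K := C_AbsRing) (V := AbsRing_NormedModule C_AbsRing)). exact Hx. }
  subst x.
  assert (HP : @locally C_UniformSpace (p z) (fun u => Cmod (u - p z)%C < eps)).
  { apply locally_Cmod. exists eps. split; [apply cond_pos|auto]. }
  assert (Hp' : @locally C_UniformSpace z (fun w => Cmod (p w - p z)%C < eps)) by exact (Hp _ HP).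
  pose proof (filter_and _ _ Hp' H) as HL. apply locally_Cmod in HL.
  destruct HL as (del & Hdel & HL). exists (mkposreal del Hdel).
  intros w Hw. change C in w. destruct (HL w Hw) as [A B].
  change (Cmod ((f w - f z) - (w - z) * d)%C <= eps * Cmod (w - z)%C).
  rewrite B. rewrite <- Ep.
  replace (f z + p w * (w - z) - f z - (w - z) * p z)%C
    with ((p w - p z) * (w - z))%C by Cring.
  rewrite Cmod_mult. apply Rmult_le_compat_r; [apply Cmod_ge_0|left; exact A].
Qed.

(** * Holomorphic functions on a square *)

Definition square (r : R) (t : C) : Prop := Rabs (Re t) < r /\ Rabs (Im t) < r.

(** The derivative is required to be continuous because Cauchy's estimate differentiates under an
    integral. Squares are the domains because the compactness argument in [uniform_ratio] runs over
    rectangles. *)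
Definition hol (r : R) (f : C -> C) : Prop :=
  exists f' : C -> C, forall t, square r t ->
    cder f t (f' t) /\ Ccont C_UniformSpace f' t.

Lemma square_0 (r : R) : 0 < r -> square r (RtoC 0).
Proof. intros H. split; simpl; rewrite Rabs_R0; exact H. Qed.

Lemma square_mono (r r' : R) (t : C) : r <= r' -> square r t -> square r' t.
Proof. intros H [A B]. split; lra. Qed.

Lemma hol_weaken (r r' : R) (f : C -> C) : r <= r' -> hol r' f -> hol r f.
Proof. intros H [f' Hf]. exists f'. intros t Ht. apply Hf. eapply square_mono; eauto. Qed.

Lemma hol_continuous (r : R) (f : C -> C) (t : C) :
  hol r f -> square r t -> Ccont C_UniformSpace f t.
Proof. intros [f' Hf] Ht. apply cder_continuous with (f' t). now apply Hf. Qed.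

Lemma hol_const (r : R) (a : C) : hol r (fun _ => a).
Proof.
exists (fun _ => RtoC 0). intros t _. split; [apply cder_const|apply continuous_const].
Qed.

Lemma hol_id (r : R) : hol r (fun t => t).
Proof.
exists (fun _ => RtoC 1). intros t _. split; [apply cder_id|apply continuous_const].
Qed.

Lemma hol_plus (r : R) (f g : C -> C) : hol r f -> hol r g -> hol r (fun t => f t + g t)%C.
Proof.
intros [f' Hf] [g' Hg]. exists (fun t => f' t + g' t)%C. intros t Ht.
destruct (Hf t Ht), (Hg t Ht). split; [now apply cder_plus|now apply continuous_Cplus].
Qed.

Lemma hol_mult (r : R) (f g : C -> C) : hol r f -> hol r g -> hol r (fun t => f t * g t)%C.
Proof.
intros [f' Hf] [g' Hg]. exists (fun t => f' t * g t + f t * g' t)%C. intros t Ht.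
destruct (Hf t Ht) as [A A'], (Hg t Ht) as [B B']. split; [now apply cder_mult|].
apply continuous_Cplus; apply continuous_Cmult; try assumption.
- apply cder_continuous with (1 := B).
- apply cder_continuous with (1 := A).
Qed.

Lemma hol_scal (r : R) (k : C) (f : C -> C) : hol r f -> hol r (fun t => k * f t)%C.
Proof. intros H. apply hol_mult; [apply hol_const|exact H]. Qed.

Lemma hol_minus (r : R) (f g : C -> C) : hol r f -> hol r g -> hol r (fun t => f t - g t)%C.
Proof.
intros [f' Hf] [g' Hg]. exists (fun t => f' t - g' t)%C. intros t Ht.
destruct (Hf t Ht), (Hg t Ht). split; [now apply cder_minus|now apply continuous_Cminus].
Qed.

Lemma hol_inv (r : R) (f : C -> C) :
  hol r f -> (forall t, square r t -> f t <> RtoC 0) -> hol r (fun t => / f t)%C.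
Proof.
intros [f' Hf] H0. exists (fun t => - (f' t / (f t * f t)))%C. intros t Ht.
destruct (Hf t Ht) as [A B]. specialize (H0 t Ht).
pose proof (cder_continuous _ _ _ A) as Hc.
split; [now apply cder_inv|].
apply continuous_Copp, continuous_Cmult; [exact B|].
apply continuous_Cinv; [now apply continuous_Cmult|now apply Cmult_neq_0].
Qed.

Lemma hol_Cexp (r : R) (f : C -> C) : hol r f -> hol r (fun t => Cexp (f t)).
Proof.
intros [f' Hf]. exists (fun t => Cexp (f t) * f' t)%C. intros t Ht.
destruct (Hf t Ht) as [A B]. split.
- apply cder_comp; [apply cder_Cexp|exact A].
- apply continuous_Cmult; [|exact B]. apply continuous_Cexp_fun, (cder_continuous _ _ _ A).
Qed.

Lemma hol_Clog (r : R) (f : C -> C) :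
  hol r f -> (forall t, square r t -> 0 < Re (f t)) -> hol r (fun t => Clog (f t)).
Proof.
intros [f' Hf] H0. exists (fun t => / f t * f' t)%C. intros t Ht.
destruct (Hf t Ht) as [A B]. specialize (H0 t Ht). split.
- apply (cder_comp Clog f); [now apply cder_Clog|exact A].
- apply continuous_Cmult; [|exact B].
  apply continuous_Cinv; [apply (cder_continuous _ _ _ A)|now apply Re_pos_neq0].
Qed.

Lemma square_scal (r s : R) (t : C) : 0 <= s <= 1 -> square r t -> square r (RtoC s * t)%C.
Proof.
intros Hs [A B]. unfold square.
replace (Re (RtoC s * t)) with (s * Re t) by (simpl; unfold Re; ring).
replace (Im (RtoC s * t)) with (s * Im t) by (simpl; unfold Im; ring).
rewrite !Rabs_mult, (Rabs_pos_eq s) by lra.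
pose proof (Rabs_pos (Re t)). pose proof (Rabs_pos (Im t)). split; nra.
Qed.

Lemma hol_rescale (r s : R) (f : C -> C) :
  0 <= s <= 1 -> hol r f -> hol r (fun t => f (RtoC s * t)%C).
Proof.
intros Hs [f' Hf]. exists (fun t => f' (RtoC s * t) * (RtoC s * RtoC 1))%C. intros t Ht.
destruct (Hf _ (square_scal r s t Hs Ht)) as [A B]. split.
- apply (cder_comp f (fun u => RtoC s * u)%C); [exact A|].
  apply cder_scal, cder_id.
- apply continuous_Cmult; [|apply continuous_const].
  apply (continuous_comp (U:=C_UniformSpace) (V:=C_UniformSpace) (fun u => RtoC s * u)%C f' t); [|exact B].
  apply continuous_Cmult; [apply continuous_const|apply continuous_id].
Qed.

(** The quotient is [1 + (a - b) / b], a point of the open unit disc about 1. *)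
Lemma Re_div_pos (a b : C) : Cmod (a - b) < Cmod b -> 0 < Re (a / b).
Proof.
intros H. assert (Hb : b <> RtoC 0).
{ apply Cmod_gt_0. pose proof (Cmod_ge_0 (a - b)). lra. }
replace (a / b)%C with (RtoC 1 + (a - b) / b)%C by (field; exact Hb).
assert (L : Cmod ((a - b) / b) < 1).
{ rewrite Cmod_div by exact Hb. apply Rlt_div_l.
  - now apply Cmod_gt_0.
  - lra. }
pose proof (re_le_Cmod ((a - b) / b)) as L2.
pose proof (Rle_abs (- Re ((a - b) / b))) as L3. rewrite Rabs_Ropp in L3.
change (0 < 1 + Re ((a - b) / b)). lra.
Qed.

(** Uniform continuity, relative to the size of [w], on the compact square of radius [r]. This is
    the one place where a domain has to shrink from [r'] to [r], and every later loss of domain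
    comes from here. *)
Lemma uniform_ratio (r r' : R) (w : C -> C) :
  0 < r < r' -> (forall t, square r' t -> Ccont C_UniformSpace w t /\ w t <> RtoC 0) ->
  exists d, 0 < d /\ forall t t', square r t -> square r t' ->
    Rabs (Re t - Re t') < d -> Rabs (Im t - Im t') < d -> 0 < Re (w t / w t').
Proof.
intros Hr Hw.
(* The radius is doubled so that a point within [e] of a point within [e] of [(u, v)] is still
   covered. The third: two such values [a], [b] satisfy [|a - b| < 2/3 |c|] and [|b| > 2/3 |c|],
   with [c = w (u, v)]. *)
assert (P : forall u v : R, exists e : posreal, Rabs u <= r -> Rabs v <= r ->
  forall x y, Rabs (x - u) < 2 * e -> Rabs (y - v) < 2 * e ->
   Cmod (w (x, y) - w (u, v)) < Cmod (w (u, v)) / 3).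
{ intros u v. destruct (classic (Rabs u <= r /\ Rabs v <= r)) as [[Hu Hv]|Hn].
  (* Off the closed square any radius will do; [delta] only has to be total. *)
  2:{ exists (mkposreal 1 Rlt_0_1). intros; tauto. }
  assert (Hs : square r' (u, v)) by (split; simpl; lra).
  destruct (Hw _ Hs) as [Hc Hn].
  assert (HL : @locally C_UniformSpace (u, v)
    (fun t => Cmod (w t - w (u, v))%C < Cmod (w (u, v)) / 3)).
  { apply (Hc (fun z => Cmod (z - w (u, v))%C < Cmod (w (u, v)) / 3)).
    apply locally_Cmod. exists (Cmod (w (u, v)) / 3). split; [|auto].
    apply Cmod_gt_0 in Hn. lra. }
  destruct HL as [e He]. assert (He2 : 0 < e / 2) by (pose proof (cond_pos e); lra).
  exists (mkposreal _ He2). simpl. intros _ _ x y Hx Hy.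
  apply He. split.
  - change (Rabs (x - u) < e). lra.
  - change (Rabs (y - v) < e). lra. }
set (delta := fun u v => proj1_sig (constructive_indefinite_description _ (P u v))).
destruct (compactness_value_2d (- r) r (- r) r delta) as [d Hd].
exists d. split; [apply cond_pos|].
intros [x y] [x' y'] [H1 H2] [H3 H4] H5 H6. simpl in *.
(* The compactness theorem yields its tagged point under a double negation, so the goal is negated
   first. *)
apply NNPP. intros Hneg.
apply Rabs_def2 in H1; apply Rabs_def2 in H2.
apply (Hd x y); [lra|lra|]. intros (u & v & Hu & Hv & Hxu & Hyv & Hdd).
apply Hneg. clear Hneg.
assert (Q := proj2_sig (constructive_indefinite_description _ (P u v))).
cbv beta in Q. fold (delta u v) in Q.
assert (Au : Rabs u <= r) by (apply Rabs_le; lra).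
assert (Av : Rabs v <= r) by (apply Rabs_le; lra).
specialize (Q Au Av).
pose proof (cond_pos (delta u v)) as Hpos.
assert (Q1 := Q x y ltac:(lra) ltac:(lra)).
assert (Q2 : Cmod (w (x', y') - w (u, v)) < Cmod (w (u, v)) / 3).
{ apply Q.
  - replace (x' - u) with (- (x - x') + (x - u)) by ring.
    eapply Rle_lt_trans; [apply Rabs_triang|]. rewrite Rabs_Ropp. lra.
  - replace (y' - v) with (- (y - y') + (y - v)) by ring.
    eapply Rle_lt_trans; [apply Rabs_triang|]. rewrite Rabs_Ropp. lra. }
apply Re_div_pos.
set (a := w (x, y)) in *. set (b := w (x', y')) in *. set (c := w (u, v)) in *.
assert (T1 : Cmod (a - b) <= Cmod (a - c) + Cmod (b - c)).
{ replace (a - b)%C with ((a - c) + - (b - c))%C by ring.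
  eapply Rle_trans; [apply Cmod_triangle|]. rewrite Cmod_opp. lra. }
assert (T2 : Cmod c <= Cmod b + Cmod (b - c)).
{ replace c with (b + - (b - c))%C at 1 by ring.
  eapply Rle_trans; [apply Cmod_triangle|]. rewrite Cmod_opp. lra. }
lra.
Qed.

(* The logarithm is assembled radially as a telescoping sum of principal
   logarithms of [w ((i+1)t/N) / w (i t/N)], which lie in the right half-plane. *)
Lemma hol_log (r r' y : R) (w : C -> C) :
  0 < r < r' -> hol r' w -> (forall t, square r' t -> w t <> RtoC 0) ->
  0 < y -> w (RtoC 0) = RtoC y ->
  exists L, hol r L /\ L (RtoC 0) = RtoC (ln y) /\
    forall t, square r t -> Cexp (L t) = w t.
Proof.
intros Hr Hw H0 Hy Ey.
destruct (uniform_ratio r r' w Hr) as (d & Hd & Hratio).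
{ intros t Ht. split; [now apply hol_continuous with (1 := Hw)|now apply H0]. }
(* With [N > r / d], consecutive points [i t / N] and [(i + 1) t / N] of a ray differ by less than
   [d] in each coordinate. *)
destruct (INR_unbounded (r / d)) as [N HN].
assert (HNp : 0 < INR N).
{ eapply Rlt_trans; [|exact HN]. apply Rdiv_lt_0_compat; lra. }
assert (HwR : hol r w) by (apply hol_weaken with r'; [lra|exact Hw]).
assert (Hfrac : forall i, (i <= N)%nat -> 0 <= INR i / INR N <= 1).
{ intros i Hi. apply le_INR in Hi. pose proof (pos_INR i). split.
  - apply Rdiv_le_0_compat; lra.
  - apply Rle_div_l; lra. }
assert (Claim : forall i, (i <= N)%nat -> exists L, hol r L /\ L (RtoC 0) = RtoC (ln y) /\
    forall t, square r t -> Cexp (L t) = w (RtoC (INR i / INR N) * t)%C).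
{ induction i as [|i IH]; intros Hi.
  - exists (fun _ => RtoC (ln y)). split; [apply hol_const|]. split; [reflexivity|].
    intros t Ht. rewrite Cexp_R, exp_ln by exact Hy. rewrite <- Ey. f_equal.
    simpl. unfold Rdiv. rewrite Rmult_0_l. ring.
  - destruct IH as (L & HL & HL0 & HLe); [lia|].
    pose proof (Hfrac i ltac:(lia)) as F1. pose proof (Hfrac (S i) Hi) as F2.
    set (s := INR i / INR N) in *. set (s' := INR (S i) / INR N) in *.
    assert (Hpos : forall t, square r t -> 0 < Re (w (RtoC s' * t) / w (RtoC s * t))%C).
    { intros t Ht. assert (Es : s' - s = / INR N).
      { unfold s, s'. rewrite S_INR. field. lra. }
      assert (B : r * / INR N < d).
      { apply Rlt_div_l in HN; [|exact Hd]. apply (Rmult_lt_reg_r (INR N)); [exact HNp|].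
        rewrite Rmult_assoc, Rinv_l by lra. lra. }
      assert (HNi : 0 < / INR N) by now apply Rinv_0_lt_compat.
      destruct (Ht) as [A1 A2].
      apply Hratio; try (apply square_scal; assumption).
      - replace (Re (RtoC s' * t) - Re (RtoC s * t)) with ((s' - s) * Re t)
          by (simpl; unfold Re; ring).
        rewrite Es, Rabs_mult, (Rabs_pos_eq (/ INR N)) by lra. nra.
      - replace (Im (RtoC s' * t) - Im (RtoC s * t)) with ((s' - s) * Im t)
          by (simpl; unfold Im; ring).
        rewrite Es, Rabs_mult, (Rabs_pos_eq (/ INR N)) by lra. nra. }
    assert (Hnz : forall t, square r t -> w (RtoC s * t)%C <> RtoC 0).
    { intros t Ht. apply H0, square_mono with r; [lra|]. now apply square_scal. }
    exists (fun t => L t + Clog (w (RtoC s' * t) / w (RtoC s * t)))%C.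
    split; [|split].
    + apply hol_plus; [exact HL|]. apply hol_Clog; [|exact Hpos].
      apply hol_mult; [now apply hol_rescale|].
      apply hol_inv; [now apply hol_rescale|exact Hnz].
    + replace (RtoC s' * RtoC 0)%C with (RtoC 0) by ring.
      replace (RtoC s * RtoC 0)%C with (RtoC 0) by ring.
      rewrite HL0, Ey. replace (RtoC y / RtoC y)%C with (RtoC 1).
      * rewrite Clog_R by lra. rewrite ln_1. ring.
      * field. intros E. apply (f_equal Re) in E. simpl in E. lra.
    + intros t Ht. rewrite Cexp_plus, HLe by exact Ht.
      rewrite Cexp_Clog by now apply Hpos. field. now apply Hnz. }
destruct (Claim N (le_n N)) as (L & HL & HL0 & HLe).
exists L. split; [exact HL|]. split; [exact HL0|].
intros t Ht. rewrite HLe by exact Ht. f_equal.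
unfold Rdiv. rewrite Rinv_r by lra. ring.
Qed.

(** * Cauchy's estimate *)

Lemma cder_horizontal (f : C -> C) (x y : R) (d : C) :
  cder f (x, y) d -> is_derive (fun u : R => Re (f (u, y))) x (Re d).
Proof.
intros H. apply cder_is_derive in H. destruct H as [_ H].
split; [apply (is_linear_scal_l (K := R_AbsRing) (V := R_NormedModule))|].
intros x' Hx' eps.
assert (E : x = x').
{ apply (is_filter_lim_locally_unique (K := R_AbsRing) (V := R_NormedModule)). exact Hx'. }
subst x'.
specialize (H (x, y) (fun P HP => HP) eps). destruct H as [e He].
exists e. intros u Hu.
assert (Eu : (((u, y) : C) - (x, y))%C = RtoC (u - x)) by (apply C_ext; simpl; ring).
assert (Hb : @ball (AbsRing_UniformSpace C_AbsRing) (x, y) e (u, y)).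
{ change (Cmod (((u, y) : C) - (x, y))%C < e). rewrite Eu, Cmod_R. exact Hu. }
specialize (He _ Hb).
change (Cmod ((f (u, y) - f (x, y)) - (((u, y) : C) - (x, y)) * d)%C
  <= eps * Cmod (((u, y) : C) - (x, y))%C) in He.
rewrite Eu, Cmod_R in He.
change (Rabs ((Re (f (u, y)) - Re (f (x, y))) - (u - x) * Re d) <= eps * Rabs (u - x)).
eapply Rle_trans; [|exact He]. eapply Rle_trans; [|apply re_le_Cmod].
apply Req_le. f_equal. simpl. unfold Re. ring.
Qed.

(** One Cauchy-Riemann equation, from the horizontal case by rotation: [w |-> -i f(i w)] has real
    part [Im (f (i w))] and derivative [-i d i = d]. *)
Lemma cder_vertical (f : C -> C) (x y : R) (d : C) :
  cder f (x, y) d -> is_derive (fun v : R => Im (f (x, v))) y (Re d).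
Proof.
intros H.
assert (H2 : cder (fun w => - Ci * f (Ci * w))%C (y, (- x)%R) (- Ci * (d * (Ci * 1)))%C).
{ apply cder_scal. apply (cder_comp f (fun w => Ci * w)%C).
  - replace (Ci * (y, (- x)%R))%C with ((x, y) : C); [exact H|].
    apply C_ext; simpl; ring.
  - apply cder_scal, cder_id. }
apply cder_horizontal in H2.
replace (Re d) with (Re (- Ci * (d * (Ci * 1)))%C) by (simpl; unfold Re; ring).
apply is_derive_ext with (2 := H2). intros v. change R in v.
replace (Ci * (v, (- x)%R))%C with ((x, v) : C) by (apply C_ext; simpl; ring).
simpl. unfold Im. ring.
Qed.

Lemma continuous_vertical (f : C -> C) (x y : R) :
  Ccont C_UniformSpace f (x, y) -> Ccont R_UniformSpace (fun v : R => f (x, v)) y.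
Proof.
intros H. apply (continuous_comp (fun v : R => ((x, v) : C_UniformSpace)) f); [|exact H].
apply continuous_Cpair; [apply continuous_const|apply continuous_id].
Qed.

(* By Cauchy-Riemann the derivative of the mean is the increment of [Im G] over a period. *)
Lemma periodic_mean_const (G G' : C -> C) (a : R) :
  (forall z, Re z < a -> cder G z (G' z) /\ Ccont C_UniformSpace G' z) ->
  (forall x, x < a -> Im (G (x, (2 * PI)%R)) = Im (G (x, 0))) ->
  forall x y, x < a -> y < a ->
  RInt (fun t => Re (G (x, t))) 0 (2 * PI) = RInt (fun t => Re (G (y, t))) 0 (2 * PI).
Proof.
intros HG Hper.
assert (D : forall x, x < a ->
  is_derive (fun u : R => RInt (fun t => Re (G (u, t))) 0 (2 * PI)) x 0).
{ intros x Hx.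
  assert (Lx : locally x (fun u : R => u < a)) by (apply (open_lt a x); exact Hx).
  assert (E0 : RInt (fun t => Derive (fun u => Re (G (u, t))) x) 0 (2 * PI) = 0).
  { rewrite (RInt_ext _ (fun t => Re (G' (x, t)))).
    2:{ intros t _. apply is_derive_unique, cder_horizontal. now apply HG. }
    apply is_RInt_unique.
    replace 0 with (minus (Im (G (x, (2 * PI)%R))) (Im (G (x, 0)))) at 2.
    2:{ rewrite Hper by exact Hx. apply (minus_eq_zero (G := R_AbelianGroup)). }
    apply (is_RInt_derive (fun t => Im (G (x, t)))).
    - intros t _. apply cder_vertical. now apply HG.
    - intros t _. apply continuous_Re.
      apply continuous_vertical. now apply HG. }
  (* Differentiation under the integral produces the integral of the partial derivatives, so the [0]
     of the goal is traded for that integral. *)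
  refine (eq_ind _ (fun l : R => is_derive _ x l) _ _ E0).
  apply (is_derive_RInt_param (fun u t => Re (G (u, t)))).
  - revert Lx. apply filter_imp. intros u Hu t _.
    exists (Re (G' (u, t))). apply cder_horizontal. now apply HG.
  - intros t _.
    apply continuity_2d_pt_ext_loc with (fun u v => Re (G' (u, v))).
    + destruct Lx as [e He]. exists e. intros u v Hu _. symmetry.
      apply is_derive_unique, cder_horizontal. apply HG. simpl. apply He. exact Hu.
    + apply continuity_2d_pt_filterlim.
      apply (continuous_ext (fun z : C_UniformSpace => Re (G' z))
        (fun z : C_UniformSpace => Re (G' (fst z, snd z))) (x, t)); [intros [p q]; reflexivity|].
      apply continuous_Re. now apply HG.
  - revert Lx. apply filter_imp. intros u Hu.
    apply (ex_RInt_continuous (V := R_CompleteNormedModule)). intros t _.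
    apply continuous_Re. apply continuous_vertical.
    apply cder_continuous with (G' (u, t)). now apply HG. }
intros x y Hx Hy.
set (m := fun u : R => RInt (fun t => Re (G (u, t))) 0 (2 * PI)).
change (m x = m y).
destruct (MVT_gen m x y (fun _ => 0))
  as [c [_ Hc]].
- intros u Hu. apply D. destruct Hu as [_ Hu]. apply Rlt_le_trans with (1 := Hu).
  unfold Rmax; destruct (Rle_dec x y); lra.
- intros u Hu. apply continuity_pt_filterlim.
  apply (ex_derive_continuous (K := R_AbsRing) (V := R_NormedModule) m u).
  exists 0. apply D. destruct Hu as [_ Hu]. apply Rle_lt_trans with (1 := Hu).
  unfold Rmax; destruct (Rle_dec x y); lra.
- lra.
Qed.

Lemma RInt_const_bounds (f : R -> R) (b lo hi : R) :
  0 <= b -> (forall t, continuous f t) -> (forall t, lo <= f t <= hi) ->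
  lo * b <= RInt f 0 b <= hi * b.
Proof.
intros Hb Hc Hf.
assert (Hi : ex_RInt f 0 b).
{ apply (ex_RInt_continuous (V := R_CompleteNormedModule)). intros t _; apply Hc. }
assert (K : forall k : R, RInt (fun _ : R => k) 0 b = k * b).
{ intros k. rewrite RInt_const. unfold scal; simpl. unfold mult; simpl. ring. }
rewrite <- (K lo), <- (K hi).
split; apply RInt_le; try assumption; try (apply ex_RInt_const); intros t _; apply Hf.
Qed.

(** Under [t = Cexp z], circles about 0 become vertical segments of length one period, and [G z] is
    the quotient [(f t - f 0) / t]. Its real mean is the same on all circles: near 0 it is close to
    [Re d], and on the circle of radius [r / 2] it is at most [2 M / (r / 2)]. *)
Lemma cauchy_estimate (r M : R) (f : C -> C) (d : C) :
  0 < r -> hol r f -> (forall t, square r t -> Cmod (f t) <= M) ->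
  cder f (RtoC 0) d -> Re d <= 4 * M / r.
Proof.
intros Hr [f' Hf] HM Hd.
set (G := fun z => ((f (Cexp z) - f (RtoC 0)) * Cexp (- z))%C).
set (G' := fun z => ((f' (Cexp z) * Cexp z - RtoC 0) * Cexp (- z)
   + (f (Cexp z) - f (RtoC 0)) * (Cexp (- z) * (- RtoC 1)))%C).
assert (Hsq : forall z, Re z < ln r -> square r (Cexp z)).
{ intros z Hz.
  assert (Cmod (Cexp z) < r).
  { rewrite Cmod_Cexp. rewrite <- (exp_ln r) by exact Hr. now apply exp_increasing. }
  split; (eapply Rle_lt_trans; [|eassumption]); [apply re_le_Cmod|apply Im_le_Cmod]. }
assert (HG : forall z, Re z < ln r -> cder G z (G' z) /\ Ccont C_UniformSpace G' z).
{ intros z Hz. destruct (Hf _ (Hsq z Hz)) as [A B].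
  assert (Ce : Ccont C_UniformSpace Cexp z)
    by (apply (continuous_Cexp_fun (fun w : C_UniformSpace => w)), continuous_id).
  assert (Cem : Ccont C_UniformSpace (fun w => Cexp (- w)) z)
    by (apply continuous_Cexp_fun, continuous_Copp, continuous_id).
  assert (Cf : Ccont C_UniformSpace (fun w => f (Cexp w)) z)
    by exact (continuous_comp (U:=C_UniformSpace) (V:=C_UniformSpace) Cexp f z Ce (cder_continuous _ _ _ A)).
  assert (Cf' : Ccont C_UniformSpace (fun w => f' (Cexp w)) z)
    by exact (continuous_comp (U:=C_UniformSpace) (V:=C_UniformSpace) Cexp f' z Ce B).
  split.
  - apply (cder_mult (fun w => f (Cexp w) - f (RtoC 0))%C (fun w => Cexp (- w))).
    + apply cder_minus; [|apply cder_const]. apply (cder_comp f Cexp); [exact A|apply cder_Cexp].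
    + apply (cder_comp Cexp (fun w => - w)%C); [apply cder_Cexp|]. apply (cder_opp (fun w => w)), cder_id.
  - unfold G'. apply continuous_Cplus; apply continuous_Cmult; try assumption.
    + apply continuous_Cminus; [|apply continuous_const]. now apply continuous_Cmult.
    + apply continuous_Cminus; [assumption|apply continuous_const].
    + apply continuous_Cmult; [assumption|apply continuous_const]. }
assert (Hper : forall x, x < ln r -> Im (G (x, (2 * PI)%R)) = Im (G (x, 0))).
{ intros x _. unfold G. rewrite !Cexp_opp.
  replace ((x, (2 * PI)%R) : C) with ((x, 0) + two_pi_i 1)%C
    by (apply C_ext; simpl; ring).
  now rewrite Cexp_period. }
assert (Hcont : forall x, x < ln r -> forall t : R, continuous (fun t : R => Re (G (x, t))) t).
{ intros x Hx t. apply continuous_Re, continuous_vertical.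
  apply cder_continuous with (G' (x, t)). now apply HG. }
apply le_epsilon. intros eta Heta.
pose proof PI_RGT_0 as Hpi.
assert (HM0 : 0 <= M).
{ eapply Rle_trans; [apply Cmod_ge_0|]. apply (HM (RtoC 0)). now apply square_0. }
destruct Hd as (phi & Hc & Ed & HL).
assert (L1 : @locally C_UniformSpace (RtoC 0) (fun t => Cmod (phi t - d)%C < eta)).
{ apply (Hc (fun z => Cmod (z - d)%C < eta)). apply locally_Cmod.
  exists eta. rewrite Ed. auto. }
pose proof (filter_and _ _ L1 HL) as L2. apply locally_Cmod in L2.
destruct L2 as (del & Hdel & L2).
(* The logarithm of a radius within the square and so small that the slope of [f] at 0 is within
   [eta] of [d] there. *)
set (u0 := ln (Rmin del r / 2)).
assert (Hmin : 0 < Rmin del r) by (apply Rmin_glb_lt; lra).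
assert (Hmin2 : Rmin del r <= del /\ Rmin del r <= r) by (split; [apply Rmin_l|apply Rmin_r]).
assert (Hu0 : u0 < ln r) by (apply ln_increasing; lra).
assert (Hr2 : ln (r / 2) < ln r) by (apply ln_increasing; lra).
destruct (RInt_const_bounds (fun t => Re (G (u0, t))) (2 * PI) (Re d - eta)
  (Re d + eta) ltac:(lra) (Hcont u0 Hu0)) as [Lo _].
{ intros t.
  assert (E : G (u0, t) = phi (Cexp (u0, t))).
  { destruct (L2 (Cexp (u0, t))) as [_ E].
    - replace (Cexp (u0, t) - RtoC 0)%C with (Cexp (u0, t)) by ring.
      rewrite Cmod_Cexp. simpl. unfold u0. rewrite exp_ln; lra.
    - unfold G. rewrite E, Cexp_opp. field. apply Cexp_neq0. }
  rewrite E. destruct (L2 (Cexp (u0, t))) as [Q _].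
  { replace (Cexp (u0, t) - RtoC 0)%C with (Cexp (u0, t)) by ring.
    rewrite Cmod_Cexp. simpl. unfold u0. rewrite exp_ln; lra. }
  pose proof (re_le_Cmod (phi (Cexp (u0, t)) - d)) as Q2.
  assert (Q3 : Rabs (Re (phi (Cexp (u0, t))) - Re d) < eta).
  { eapply Rle_lt_trans; [exact Q2|exact Q]. }
  apply Rabs_def2 in Q3. lra. }
destruct (RInt_const_bounds (fun t => Re (G (ln (r / 2), t))) (2 * PI) (- (4 * M / r))
  (4 * M / r) ltac:(lra) (Hcont _ Hr2)) as [_ Hi].
{ intros t. apply Rabs_le_between. eapply Rle_trans; [apply re_le_Cmod|].
  unfold G. rewrite Cmod_mult, Cmod_Cexp. simpl.
  rewrite exp_Ropp, exp_ln by lra.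
  assert (B : Cmod (f (Cexp (ln (r / 2), t)) - f (RtoC 0)) <= 2 * M).
  { unfold Cminus. eapply Rle_trans; [apply Cmod_triangle|]. rewrite Cmod_opp.
    pose proof (HM _ (Hsq (ln (r / 2), t) Hr2)). pose proof (HM _ (square_0 r Hr)). lra. }
  replace (4 * M / r) with (2 * M * / (r / 2)) by (field; lra).
  apply Rmult_le_compat_r; [|exact B]. left. apply Rinv_0_lt_compat. lra. }
rewrite (periodic_mean_const G G' (ln r) HG Hper u0 (ln (r / 2)) Hu0 Hr2) in Lo.
nra.
Qed.

(** * The inverse branch of [1 / Phi] *)

(** The branch of [z^(-1/l)] on the right half-plane that is positive on the positive reals. *)
Definition psi (l : R) (z : C) : C := Cexp (RtoC (- / l) * Clog z)%C.

Lemma Im_scal (x : R) (z : C) : Im (RtoC x * z)%C = x * Im z.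
Proof. simpl. unfold Im. ring. Qed.

Lemma Re_scal (x : R) (z : C) : Re (RtoC x * z)%C = x * Re z.
Proof. simpl. unfold Re. ring. Qed.

Lemma PI2l_le (l : R) : 1 <= l -> PI / (2 * l) <= PI / 2.
Proof.
intros Hl. pose proof PI_RGT_0. apply Rmult_le_compat_l; [lra|].
apply Rinv_le_contravar; lra.
Qed.

(** Since [atan] is bounded by [PI / 2] whatever its argument, no condition on [z] enters; division
    by [l] gives the half-angle of the sector. *)
Lemma psi_arg (l : R) (z : C) :
  1 <= l -> Rabs (Im (RtoC (- / l) * Clog z)%C) < PI / (2 * l).
Proof.
intros Hl. rewrite Im_scal, Rabs_mult, Rabs_Ropp.
assert (0 < / l) by (apply Rinv_0_lt_compat; lra).
rewrite (Rabs_pos_eq (/ l)) by lra.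
replace (PI / (2 * l)) with (/ l * (PI / 2)) by (field; lra).
apply Rmult_lt_compat_l; [assumption|apply Im_Clog_bound].
Qed.

Lemma psi_arg' (l : R) (z : C) :
  1 <= l -> Rabs (Im (RtoC (- / l) * Clog z)%C) < PI / 2.
Proof.
intros Hl. eapply Rlt_le_trans; [now apply psi_arg|now apply PI2l_le].
Qed.

Lemma Re_psi_pos (l : R) (z : C) : 1 <= l -> 0 < Re (psi l z).
Proof. intros Hl. apply Re_Cexp_pos. now apply psi_arg'. Qed.

Lemma Clog_psi (l : R) (z : C) : 1 <= l -> Clog (psi l z) = (RtoC (- / l) * Clog z)%C.
Proof. intros Hl. apply Clog_Cexp. now apply psi_arg'. Qed.

Lemma Phi_Clog (l : R) (z : C) : Phi l z = Cexp (RtoC l * Clog z).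
Proof.
unfold Phi, Cexp. rewrite Im_scal, Re_scal. unfold Clog; simpl. reflexivity.
Qed.

Lemma Phi_psi (l : R) (z : C) : 1 <= l -> 0 < Re z -> Phi l (psi l z) = (/ z)%C.
Proof.
intros Hl Hz. rewrite Phi_Clog, Clog_psi by exact Hl.
replace (RtoC l * (RtoC (- / l) * Clog z))%C with (- Clog z)%C.
- rewrite Cexp_opp, Cexp_Clog by exact Hz. reflexivity.
- rewrite RtoC_opp, RtoC_inv by lra. field. intros E. apply (f_equal Re) in E. simpl in E. lra.
Qed.

(** The bound on [l * Im (Clog z)] expresses that [z] lies in the sector; it lets the principal
    logarithm recover [l * Clog z] from [Phi l z]. *)
Lemma psi_Phi (l : R) (z : C) :
  1 <= l -> 0 < Re z -> Rabs (l * Im (Clog z)) < PI / 2 -> psi l (/ Phi l z) = z.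
Proof.
intros Hl Hz Ha. rewrite Phi_Clog, <- Cexp_opp. unfold psi. rewrite Clog_Cexp.
- replace (RtoC (- / l) * - (RtoC l * Clog z))%C with (Clog z); [now apply Cexp_Clog|].
  rewrite RtoC_opp, RtoC_inv by lra. field.
  intros E. apply (f_equal Re) in E. simpl in E. lra.
- change (Im (- (RtoC l * Clog z))%C) with (- Im (RtoC l * Clog z)%C).
  rewrite Rabs_Ropp, Im_scal. exact Ha.
Qed.

Lemma Phi_neq0 (l : R) (z : C) : Phi l z <> RtoC 0.
Proof. rewrite Phi_Clog. apply Cexp_neq0. Qed.

Lemma psi_inj (l : R) (z w : C) :
  1 <= l -> 0 < Re z -> 0 < Re w -> psi l z = psi l w -> z = w.
Proof.
intros Hl Hz Hw H.
assert (E : (/ z)%C = (/ w)%C) by (rewrite <- (Phi_psi l z), <- (Phi_psi l w), H; auto).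
apply Re_pos_neq0 in Hz. apply Re_pos_neq0 in Hw.
replace z with (/ / z)%C by (field; exact Hz). rewrite E. field. exact Hw.
Qed.

Lemma Cmod_psi (l : R) (z : C) : Cmod (psi l z) = Rpower (Cmod z) (- / l).
Proof. unfold psi. rewrite Cmod_Cexp, Re_scal. reflexivity. Qed.

(** Since [|z| >= Re z > x^(-l)], the decreasing power [-1/l] gives the bound. It confines both U
    and the lifted motions to a disc. *)
Lemma Cmod_psi_lt (l x : R) (z : C) :
  1 <= l -> 0 < x -> / Rpower x l < Re z -> Cmod (psi l z) < x.
Proof.
intros Hl Hx Hz.
assert (Hp : 0 < Rpower x l) by apply exp_pos.
assert (Hi : 0 < / Rpower x l) by now apply Rinv_0_lt_compat.
assert (Hm : / Rpower x l < Cmod z).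
{ eapply Rlt_le_trans; [exact Hz|]. eapply Rle_trans; [apply Rle_abs|apply re_le_Cmod]. }
rewrite Cmod_psi, Rpower_Ropp.
assert (Hil : 0 < / l) by (apply Rinv_0_lt_compat; lra).
replace x with (/ Rpower (/ Rpower x l) (/ l)) at 1.
- apply Rinv_lt_contravar.
  + apply Rmult_lt_0_compat; apply exp_pos.
  + apply Rlt_Rpower_l; lra.
- rewrite <- (Rpower_Ropp x l), Rpower_mult, <- Rpower_Ropp.
  replace (- (- l * / l)) with 1 by (field; lra). now apply Rpower_1.
Qed.

Lemma psi_R (l x : R) : 1 <= l -> 0 < x -> psi l (RtoC (/ Rpower x l)) = RtoC x.
Proof.
intros Hl Hx. assert (Hp : 0 < Rpower x l) by apply exp_pos.
unfold psi. rewrite Clog_R by now apply Rinv_0_lt_compat.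
rewrite <- RtoC_mult, Cexp_R. f_equal.
rewrite ln_Rinv by exact Hp. unfold Rpower. rewrite ln_exp.
replace (- / l * - (l * ln x)) with (ln x) by (field; lra). now apply exp_ln.
Qed.

Lemma cder_psi (l : R) (z : C) :
  0 < Re z -> cder (psi l) z (psi l z * (RtoC (- / l) * / z))%C.
Proof.
intros Hz. apply (cder_comp Cexp (fun w => RtoC (- / l) * Clog w)%C).
- apply cder_Cexp.
- apply cder_scal. now apply cder_Clog.
Qed.

Lemma continuous_psi {T : UniformSpace} (l : R) (f : T -> C) (x : T) :
  Ccont T f x -> 0 < Re (f x) -> Ccont T (fun t => psi l (f t)) x.
Proof.
intros Hf H. apply continuous_Cexp_fun, continuous_Cmult; [apply continuous_const|].
now apply continuous_Clog_fun.
Qed.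

(** * Polynomial functions and interpolation *)

(** Kept as an inductive class because what is needed, composition with [hol] and a Lipschitz bound
    on discs, goes by induction on the construction. *)
Inductive polyfun : (C -> C) -> Prop :=
| polyfun_const (a : C) : polyfun (fun _ => a)
| polyfun_id : polyfun (fun z => z)
| polyfun_plus (f g : C -> C) : polyfun f -> polyfun g -> polyfun (fun z => f z + g z)%C
| polyfun_mult (f g : C -> C) : polyfun f -> polyfun g -> polyfun (fun z => f z * g z)%C.

Lemma polyfun_hol (h : C -> C) (r : R) (f : C -> C) :
  polyfun h -> hol r f -> hol r (fun t => h (f t)).
Proof.
intros Hh Hf. induction Hh.
- apply hol_const.
- exact Hf.
- now apply hol_plus.
- now apply hol_mult.
Qed.

Lemma polyfun_lipschitz (h : C -> C) (M : R) :
  polyfun h -> 0 <= M -> exists K, 0 <= K /\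
    forall z w, Cmod z <= M -> Cmod w <= M -> Cmod (h z - h w) <= K * Cmod (z - w).
Proof.
intros Hh HM. induction Hh as [a| |f g Hf [K [HK Kf]] Hg [K' [HK' Kg]]|f g Hf [K [HK Kf]] Hg [K' [HK' Kg]]].
- exists 0. split; [lra|]. intros z w _ _.
  replace (a - a)%C with (RtoC 0) by ring. rewrite Cmod_0. lra.
- exists 1. split; [lra|]. intros z w _ _. lra.
- exists (K + K'). split; [lra|]. intros z w Hz Hw.
  replace (f z + g z - (f w + g w))%C with ((f z - f w) + (g z - g w))%C by ring.
  eapply Rle_trans; [apply Cmod_triangle|].
  specialize (Kf z w Hz Hw). specialize (Kg z w Hz Hw). lra.
(* A Lipschitz function is bounded on the disc, by its value at 0 plus [k * M]; with these bounds
   the product is handled by adding and subtracting [f w * g z]. *)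
- assert (B : forall (q : C -> C) k, 0 <= k -> (forall z w, Cmod z <= M -> Cmod w <= M ->
      Cmod (q z - q w) <= k * Cmod (z - w)) ->
      forall z, Cmod z <= M -> Cmod (q z) <= Cmod (q (RtoC 0)) + k * M).
  { intros q k Hk Hq z Hz.
    replace (q z) with (q (RtoC 0) + (q z - q (RtoC 0)))%C by ring.
    eapply Rle_trans; [apply Cmod_triangle|].
    specialize (Hq z (RtoC 0) Hz). rewrite Cmod_0 in Hq. specialize (Hq HM).
    replace (z - RtoC 0)%C with z in Hq by ring.
    assert (k * Cmod z <= k * M) by now apply Rmult_le_compat_l. lra. }
  pose proof (B f K HK Kf) as Bf. pose proof (B g K' HK' Kg) as Bg. clear B.
  set (A := Cmod (f (RtoC 0)) + K * M) in *. set (A' := Cmod (g (RtoC 0)) + K' * M) in *.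
  assert (0 <= A) by (eapply Rle_trans; [apply Cmod_ge_0|]; apply (Bf (RtoC 0)); rewrite Cmod_0; lra).
  assert (0 <= A') by (eapply Rle_trans; [apply Cmod_ge_0|]; apply (Bg (RtoC 0)); rewrite Cmod_0; lra).
  exists (K * A' + A * K'). split.
  { apply Rplus_le_le_0_compat; now apply Rmult_le_pos. }
  intros z w Hz Hw.
  replace (f z * g z - f w * g w)%C with ((f z - f w) * g z + f w * (g z - g w))%C by ring.
  eapply Rle_trans; [apply Cmod_triangle|]. rewrite !Cmod_mult.
  rewrite Rmult_plus_distr_r. apply Rplus_le_compat.
  + replace (K * A' * Cmod (z - w)) with (K * Cmod (z - w) * A') by ring.
    apply Rmult_le_compat; try apply Cmod_ge_0; auto.
  + rewrite Rmult_assoc. apply Rmult_le_compat; try apply Cmod_ge_0; auto.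
Qed.

Lemma polyfun_nodes (x : nat -> C) (n : nat) :
  exists P, polyfun P /\ P (RtoC 0) = RtoC 0 /\ (forall i, (i < n)%nat -> P (x i) = RtoC 0) /\
    (forall z, z <> RtoC 0 -> (forall i, (i < n)%nat -> z <> x i) -> P z <> RtoC 0).
Proof.
induction n as [|n (P & HP & H0 & Hi & Hz)].
- exists (fun z => z). split; [constructor|]. split; [reflexivity|]. split; [intros; lia|auto].
- exists (fun z => P z * (z + - x n))%C. split; [repeat constructor; assumption|].
  split; [rewrite H0; ring|]. split.
  + intros i Hin. destruct (Nat.eq_dec i n) as [->|]; [ring|].
    rewrite Hi by lia. ring.
  + intros z Hz0 Hzi. apply Cmult_neq_0.
    * apply Hz; [exact Hz0|]. intros i Hin. apply Hzi. lia.
    * intros E. apply (Hzi n); [lia|]. replace z with (z + - x n + x n)%C by ring. rewrite E. ring.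
Qed.

(** Newton's scheme: each new node is corrected by a multiple of the nodal polynomial of the earlier
    ones. The extra node 0 makes [u |-> u + t h(u)] fix 0, which keeps the perturbed values off the
    puncture. *)
Lemma polyfun_interpolation (x y : nat -> C) (n : nat) :
  (forall i, (i < n)%nat -> x i <> RtoC 0) ->
  (forall i j, (i < j)%nat -> (j < n)%nat -> x j <> x i) ->
  exists h, polyfun h /\ h (RtoC 0) = RtoC 0 /\ forall i, (i < n)%nat -> h (x i) = y i.
Proof.
intros H0 Hd. induction n as [|n IH].
- exists (fun _ => RtoC 0). split; [constructor|]. split; [reflexivity|]. intros; lia.
- destruct IH as (h & Hh & Hh0 & Hhi).
  { intros; apply H0; lia. } { intros; apply Hd; lia. }
  destruct (polyfun_nodes x n) as (P & HP & HP0 & HPi & HPz).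
  assert (Hn : P (x n) <> RtoC 0).
  { apply HPz; [apply H0; lia|]. intros i Hi. apply Hd; lia. }
  exists (fun z => h z + (y n - h (x n)) / P (x n) * P z)%C.
  split; [repeat constructor; assumption|]. split; [rewrite Hh0, HP0; ring|].
  intros i Hi. destruct (Nat.eq_dec i n) as [->|].
  + field. exact Hn.
  + rewrite (Hhi i), (HPi i) by lia. ring.
Qed.

(** * Lifting holomorphic motions *)

(** It agrees with [flat_map l b 0] away from 0, without the case distinction that would hinder
    differentiation; its value at 0 is meaningless. *)
Definition flat (l b x : R) : R := b * exp (- / Rpower (Rabs x) l).

Definition dflat (l b x : R) : R := flat l b x * (l / (Rpower (Rabs x) l * x)).

Lemma flat_pos (l b x : R) : 0 < b -> 0 < flat l b x.
Proof. intros. apply Rmult_lt_0_compat; [assumption|apply exp_pos]. Qed.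

Lemma dflat_neq0 (l b x : R) : 1 <= l -> 0 < b -> x <> 0 -> dflat l b x <> 0.
Proof.
intros Hl Hb Hx. pose proof (flat_pos l b x Hb).
assert (0 < Rpower (Rabs x) l) by apply exp_pos.
apply Rmult_integral_contrapositive_currified; [lra|].
unfold Rdiv. apply Rmult_integral_contrapositive_currified; [lra|].
apply Rinv_neq_0_compat, Rmult_integral_contrapositive_currified; lra.
Qed.

Lemma RtoC_neq (x y : R) : x <> y -> RtoC x <> RtoC y.
Proof. intros H E. apply H. now apply (f_equal Re) in E. Qed.

Lemma hol_psi (l r : R) (f : C -> C) :
  hol r f -> (forall t, square r t -> 0 < Re (f t)) -> hol r (fun t => psi l (f t)).
Proof. intros. apply hol_Cexp, hol_scal. now apply hol_Clog. Qed.

Lemma sign_mult_abs (x : R) : sign x * Rabs x = x.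
Proof. rewrite Rmult_comm. symmetry. destruct (Rtotal_order x 0) as [H|[->|H]].
- rewrite sign_eq_m1, Rabs_left by exact H. ring.
- rewrite Rabs_R0. ring.
- rewrite sign_eq_1, Rabs_pos_eq by lra. ring.
Qed.

Lemma sign_cases (x : R) : x <> 0 -> sign x = 1 \/ sign x = -1.
Proof.
intros Hx. destruct (Rtotal_order x 0) as [H|[H|H]].
- right. now apply sign_eq_m1.
- tauto.
- left. now apply sign_eq_1.
Qed.

(** The equation [b exp(-zeta) = w] is solved by [zeta = ln b - L] with [L] a logarithm of [w], and
    [sign p] selects the component of U so that the lift starts at [p]. The function [zeta] is
    exposed because distinctness of several lifts is decided on it. *)
Lemma lift_branch (l b x0 rad r r' p : R) (w : C -> C) (dw : C) :
  1 <= l -> 0 < b -> 0 < x0 -> rad = flat l b x0 -> 0 < r < r' ->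
  hol r' w -> (forall t, square r' t -> w t <> RtoC 0 /\ Cmod (w t) < rad) ->
  p <> 0 -> w (RtoC 0) = RtoC (flat l b p) -> cder w (RtoC 0) dw ->
  exists zeta : C -> C, let z := fun t => (RtoC (sign p) * psi l (zeta t))%C in
    (forall t, square r t -> 0 < Re (zeta t) /\ (RtoC b * Cexp (- zeta t))%C = w t
       /\ Cmod (z t) < x0) /\
    hol r z /\ z (RtoC 0) = RtoC p /\ cder z (RtoC 0) (dw / RtoC (dflat l b p))%C.
Proof.
intros Hl Hb Hx0 Hrad Hr Hw Hwn Hp Hw0 Hdw.
pose proof (flat_pos l b p Hb) as Hfp.
destruct (hol_log r r' (flat l b p) w Hr Hw (fun t Ht => proj1 (Hwn t Ht)) Hfp Hw0)
  as (L & HL & HL0 & HLe).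
exists (fun t => RtoC (ln b) - L t)%C. intros z.
assert (Hsq : forall t, square r t -> square r' t) by (intros t; apply square_mono; lra).
assert (Hxl : 0 < Rpower x0 l) by apply exp_pos.
(* The bound [|w| < rad] reads [exp (Re L) < b exp(- x0^(-l))]: this is the half-plane that
   corresponds to U. *)
assert (Hre : forall t, square r t -> / Rpower x0 l < Re (RtoC (ln b) - L t)%C).
{ intros t Ht. destruct (Hwn t (Hsq t Ht)) as [_ H].
  rewrite <- HLe, Cmod_Cexp, Hrad in H by exact Ht. unfold flat in H.
  rewrite Rabs_pos_eq in H by lra.
  assert (E : b * exp (- / Rpower x0 l) = exp (ln b - / Rpower x0 l)).
  { unfold Rminus. rewrite exp_plus, exp_ln by exact Hb. reflexivity. }
  rewrite E in H. apply exp_lt_inv in H.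
  change (Re (RtoC (ln b) - L t)%C) with (ln b + - Re (L t)). lra. }
assert (Hi : 0 < / Rpower x0 l) by now apply Rinv_0_lt_compat.
assert (Hre0 : forall t, square r t -> 0 < Re (RtoC (ln b) - L t)%C).
{ intros t Ht. specialize (Hre t Ht). lra. }
assert (Hsg : Rabs (sign p) = 1).
{ destruct (sign_cases p Hp) as [-> | ->]; [rewrite Rabs_pos_eq|rewrite Rabs_left]; lra. }
assert (Hap : 0 < Rabs p) by now apply Rabs_pos_lt.
assert (HpP : 0 < Rpower (Rabs p) l) by apply exp_pos.
assert (Hz0 : (RtoC (ln b) - L (RtoC 0))%C = RtoC (/ Rpower (Rabs p) l)).
{ rewrite HL0, <- RtoC_minus. f_equal. unfold flat. rewrite ln_mult, ln_exp; [ring|exact Hb|apply exp_pos]. }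
split; [|split; [|split]].
- intros t Ht. split; [now apply Hre0|]. split.
  + replace (- (RtoC (ln b) - L t))%C with (L t + RtoC (- ln b))%C by (rewrite RtoC_opp; ring).
    rewrite Cexp_plus, HLe, Cexp_R, exp_Ropp, exp_ln, RtoC_inv by (assumption || lra).
    field. apply RtoC_neq. lra.
  + unfold z. rewrite Cmod_mult, Cmod_R, Hsg, Rmult_1_l.
    apply Cmod_psi_lt; auto.
- apply hol_scal, hol_psi; [|exact Hre0]. apply hol_minus; [apply hol_const|exact HL].
- unfold z. rewrite Hz0, psi_R by assumption. rewrite <- RtoC_mult. f_equal. apply sign_mult_abs.
- destruct HL as [L' HL']. destruct (HL' (RtoC 0) (square_0 r (proj1 Hr))) as [DL _].
  (* About [L] it is only known that [Cexp (L t) = w t]; its derivative at 0 is found by comparing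
     two derivatives of [w]. *)
  assert (DE : cder w (RtoC 0) (Cexp (L (RtoC 0)) * L' (RtoC 0))%C).
  { apply cder_ext_loc with (fun t => Cexp (L t)).
    - apply locally_Cmod. exists r. split; [lra|]. intros t Ht. apply HLe.
      replace (t - RtoC 0)%C with t in Ht by ring.
      split; (eapply Rle_lt_trans; [|exact Ht]); [apply re_le_Cmod|apply Im_le_Cmod].
    - apply (cder_comp Cexp L); [apply cder_Cexp|exact DL]. }
  pose proof (cder_unique _ _ _ _ Hdw DE) as Edw.
  rewrite HL0, Cexp_R, exp_ln in Edw by exact Hfp.
  replace (dw / RtoC (dflat l b p))%C with (RtoC (sign p) *
     ((psi l (RtoC (ln b) - L (RtoC 0)) * (RtoC (- / l) * / (RtoC (ln b) - L (RtoC 0))))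
       * (RtoC 0 - L' (RtoC 0))))%C.
  + apply cder_scal. apply (cder_comp (psi l) (fun t => RtoC (ln b) - L t)%C).
    * apply cder_psi. apply Hre0, square_0, Hr.
    * apply cder_minus; [apply cder_const|exact DL].
  + rewrite Hz0, psi_R by assumption. rewrite Edw. unfold dflat.
    rewrite RtoC_inv by lra.
    rewrite RtoC_mult, RtoC_div, !RtoC_mult, RtoC_opp, RtoC_inv
      by (try lra; apply Rmult_integral_contrapositive_currified; lra).
    set (P := RtoC (Rpower (Rabs p) l)) in *.
    assert (Es : RtoC p = (RtoC (sign p) * RtoC (Rabs p))%C)
      by (rewrite <- RtoC_mult; f_equal; symmetry; apply sign_mult_abs).
    assert (Es2 : (RtoC (sign p) * RtoC (sign p))%C = RtoC 1).
    { rewrite <- RtoC_mult. f_equal. rewrite <- (Rabs_pos_eq (sign p * sign p)), Rabs_mult, Hsg by nra. ring. }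
    assert (Np : RtoC p <> RtoC 0) by now apply RtoC_neq.
    assert (NP : P <> RtoC 0) by (apply RtoC_neq; lra).
    assert (Nl : RtoC l <> RtoC 0) by (apply RtoC_neq; lra).
    assert (Nf : RtoC (flat l b p) <> RtoC 0) by (apply RtoC_neq; lra).
    replace (RtoC (sign p) * (RtoC (Rabs p) * (- / RtoC l * / / P) * (RtoC 0 - L' (RtoC 0))))%C
      with ((RtoC (sign p) * RtoC (Rabs p)) * P / RtoC l * L' (RtoC 0))%C
      by (field; tauto).
    rewrite <- Es. field. tauto.
Qed.

(** A holomorphic motion of [p 0], ..., [p m] with velocities [v]. The confinement to [|z| < x0]
    does double duty: differences stay below [2 * x0], so lifts exist, and Cauchy's estimate bounds
    the velocities. *)
Definition motion (m : nat) (x0 : R) (p v : nat -> R) (r : R) (z : nat -> C -> C) : Prop :=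
  (forall j, (j <= m)%nat -> hol r (z j) /\ z j (RtoC 0) = RtoC (p j) /\
     cder (z j) (RtoC 0) (RtoC (v j)) /\ forall t, square r t -> Cmod (z j t) < x0) /\
  (forall i j t, (i < j <= m)%nat -> square r t -> z j t <> z i t).

Lemma motion_const (m : nat) (x0 : R) (p : nat -> R) (r : R) :
  (forall j, (j <= m)%nat -> Rabs (p j) < x0) ->
  (forall i j, (i < j <= m)%nat -> p j <> p i) ->
  motion m x0 p (fun _ => 0) r (fun j _ => RtoC (p j)).
Proof.
intros Hp Hd. split.
- intros j Hj. split; [apply hol_const|]. split; [reflexivity|].
  split; [apply cder_const|]. intros t _. rewrite Cmod_R. now apply Hp.
- intros i j t Hij _. apply RtoC_neq. now apply Hd.
Qed.

(* The lift of [z] under [F_c], after postcomposing with [u |-> u + t h(u)]. *)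
Lemma motion_lift (l b x0 rad K r r' : R) (m : nat) (p v v' : nat -> R)
    (h : C -> C) (hr : nat -> R) (z : nat -> C -> C) :
  1 <= l -> 0 < b -> 0 < x0 -> rad = flat l b x0 -> 0 < r < r' ->
  (forall j, (j < m)%nat -> p (S j) - p 0%nat = flat l b (p j) /\ p j <> 0) ->
  p m = 0 -> v' m = 0 ->
  polyfun h -> h (RtoC 0) = RtoC 0 ->
  (forall j, (j < m)%nat -> h (RtoC (p (S j) - p 0%nat)) = RtoC (hr j)) ->
  (forall j, (j < m)%nat -> dflat l b (p j) * v' j = v (S j) - v 0%nat + hr j) ->
  (forall y w, Cmod y <= 2 * x0 -> Cmod w <= 2 * x0 -> Cmod (h y - h w) <= K * Cmod (y - w)) ->
  0 <= K ->
  (forall t, square r' t -> Cmod t * K < 1 /\ 2 * x0 * (1 + Cmod t * K) <= rad) ->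
  motion m x0 p v r' z -> exists z', motion m x0 p v' r z'.
Proof.
intros Hl Hb Hx0 Hrad Hr Hp Hpm Hvm Hh Hh0 Hhr Hv HK HK0 Hsmall [Hz Hdis].
set (u := fun j t => (z (S j) t - z 0%nat t)%C).
set (w := fun j t => (u j t + t * h (u j t))%C).
assert (Hsq0 : square r' (RtoC 0)) by (apply square_0; lra).
assert (Hu : forall j t, (j < m)%nat -> square r' t -> Cmod (u j t) < 2 * x0 /\ u j t <> RtoC 0).
{ intros j t Hj Ht. split.
  - unfold u, Cminus. eapply Rle_lt_trans; [apply Cmod_triangle|]. rewrite Cmod_opp.
    destruct (Hz (S j)) as (_ & _ & _ & B1); [lia|].
    destruct (Hz 0%nat) as (_ & _ & _ & B2); [lia|].
    specialize (B1 t Ht). specialize (B2 t Ht). lra.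
  - intros E. apply (Hdis 0%nat (S j) t); [lia|exact Ht|].
    replace (z (S j) t) with (u j t + z 0%nat t)%C by (unfold u; ring). rewrite E. ring. }
(* Since [K] is a Lipschitz constant of [h] and [|t| K < 1], the map [y |-> y + t h(y)] is injective
   on the disc of radius [2 * x0]. *)
assert (Hinj : forall t y1 y2, square r' t -> Cmod y1 <= 2 * x0 -> Cmod y2 <= 2 * x0 ->
   (y1 + t * h y1 = y2 + t * h y2)%C -> y1 = y2).
{ intros t y1 y2 Ht B1 B2 E. apply NNPP. intros Hn.
  assert (Hy : (y1 - y2)%C <> RtoC 0).
  { intros E'. apply Hn. replace y1 with (y1 - y2 + y2)%C by ring. rewrite E'. ring. }
  apply Cmod_gt_0 in Hy.
  assert (E2 : (y1 - y2)%C = (- (t * (h y1 - h y2)))%C).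
  { replace (y1 - y2)%C with ((y1 + t * h y1) - y2 - t * h y1)%C by ring. rewrite E. ring. }
  specialize (HK y1 y2 B1 B2). destruct (Hsmall t Ht) as [S1 _].
  assert (E3 : Cmod (y1 - y2) <= Cmod t * (K * Cmod (y1 - y2))).
  { rewrite E2 at 1. rewrite Cmod_opp, Cmod_mult.
    apply Rmult_le_compat_l; [apply Cmod_ge_0|exact HK]. }
  nra. }
(* Nonvanishing is injectivity again, compared with the fixed point 0; the modulus is at most
   [(1 + |t| K) |u|]. *)
assert (Hw : forall j t, (j < m)%nat -> square r' t -> w j t <> RtoC 0 /\ Cmod (w j t) < rad).
{ intros j t Hj Ht. destruct (Hu j t Hj Ht) as [B1 B2].
  assert (Z0 : Cmod (RtoC 0) <= 2 * x0) by (rewrite Cmod_0; lra).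
  split.
  - intros E. apply B2. apply (Hinj t); try assumption; [lra|].
    fold (w j t). rewrite E, Hh0. ring.
  - specialize (HK (u j t) (RtoC 0) ltac:(lra) Z0). rewrite Hh0 in HK.
    replace (h (u j t) - RtoC 0)%C with (h (u j t)) in HK by ring.
    replace (u j t - RtoC 0)%C with (u j t) in HK by ring.
    destruct (Hsmall t Ht) as [_ S2].
    unfold w. eapply Rle_lt_trans; [apply Cmod_triangle|]. rewrite Cmod_mult.
    pose proof (Cmod_ge_0 t). pose proof (Cmod_ge_0 (u j t)).
    assert (Cmod t * Cmod (h (u j t)) <= Cmod t * (K * Cmod (u j t)))
      by (now apply Rmult_le_compat_l).
    assert (0 <= Cmod t * K) by (now apply Rmult_le_pos).
    nra. }
assert (Hu0 : forall j, (j < m)%nat -> u j (RtoC 0) = RtoC (p (S j) - p 0%nat)).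
{ intros j Hj. unfold u. destruct (Hz (S j)) as (_ & E1 & _); [lia|].
  destruct (Hz 0%nat) as (_ & E2 & _); [lia|]. rewrite E1, E2, <- RtoC_minus. reflexivity. }
assert (Hlift : forall j, (j < m)%nat -> exists zeta : C -> C,
   let zj := fun t => (RtoC (sign (p j)) * psi l (zeta t))%C in
    (forall t, square r t -> 0 < Re (zeta t) /\ (RtoC b * Cexp (- zeta t))%C = w j t
       /\ Cmod (zj t) < x0) /\
    hol r zj /\ zj (RtoC 0) = RtoC (p j) /\ cder zj (RtoC 0) (RtoC (v' j))).
{ intros j Hj. destruct (Hp j Hj) as [Hpj Hpn].
  destruct (Hz (S j)) as (H1 & _ & D1 & _); [lia|].
  destruct (Hz 0%nat) as (H2 & _ & D2 & _); [lia|].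
  assert (Huh : hol r' (u j)) by (now apply hol_minus).
  assert (Hhu : hol r' (fun t => h (u j t))) by (now apply polyfun_hol).
  assert (Du : cder (u j) (RtoC 0) (RtoC (v (S j)) - RtoC (v 0%nat))%C) by (now apply cder_minus).
  replace (RtoC (v' j)) with
    (RtoC (v (S j) - v 0%nat + hr j) / RtoC (dflat l b (p j)))%C.
  - apply (lift_branch l b x0 rad r r' (p j) (w j)); try assumption.
    + apply hol_plus; [exact Huh|]. apply hol_mult; [apply hol_id|exact Hhu].
    + intros t Ht. now apply Hw.
    + unfold w. rewrite Hu0 by exact Hj. rewrite Hpj. ring.
    + destruct Hhu as [g Hg]. destruct (Hg _ Hsq0) as [Dg _].
      replace (RtoC (v (S j) - v 0%nat + hr j))
        with ((RtoC (v (S j)) - RtoC (v 0%nat)) + (RtoC 1 * h (u j (RtoC 0)) + RtoC 0 * g (RtoC 0)))%C.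
      * apply (cder_plus (u j) (fun t => t * h (u j t))%C); [exact Du|].
        apply (cder_mult (fun t => t) (fun t => h (u j t))); [apply cder_id|exact Dg].
      * rewrite Hu0, Hhr by exact Hj. rewrite RtoC_plus, RtoC_minus. ring.
  - rewrite <- Hv by exact Hj. rewrite RtoC_mult. field.
    apply RtoC_neq. now apply dflat_neq0. }
assert (Hch : exists zeta : nat -> C -> C, forall j, (j < m)%nat ->
   let zj := fun t => (RtoC (sign (p j)) * psi l (zeta j t))%C in
    (forall t, square r t -> 0 < Re (zeta j t) /\ (RtoC b * Cexp (- zeta j t))%C = w j t
       /\ Cmod (zj t) < x0) /\
    hol r zj /\ zj (RtoC 0) = RtoC (p j) /\ cder zj (RtoC 0) (RtoC (v' j))).
{ apply (choice (fun j (zeta : C -> C) => (j < m)%nat ->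
   let zj := fun t => (RtoC (sign (p j)) * psi l (zeta t))%C in
    (forall t, square r t -> 0 < Re (zeta t) /\ (RtoC b * Cexp (- zeta t))%C = w j t
       /\ Cmod (zj t) < x0) /\
    hol r zj /\ zj (RtoC 0) = RtoC (p j) /\ cder zj (RtoC 0) (RtoC (v' j)))).
  intros j. destruct (lt_dec j m) as [Hj|Hj].
  - destruct (Hlift j Hj) as [zeta Hzeta]. exists zeta. intros _. exact Hzeta.
  - exists (fun t => t). intros; lia. }
destruct Hch as [zeta Hzeta]. clear Hlift.
assert (Hsign : forall j, (j < m)%nat -> sign (p j) = 1 \/ sign (p j) = -1).
{ intros j Hj. now apply sign_cases, Hp. }
(* The last point is the critical point 0; it stays put, in agreement with [v' m = 0]. *)
exists (fun j t => if lt_dec j m then (RtoC (sign (p j)) * psi l (zeta j t))%C else RtoC 0).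
split.
- intros j Hj. destruct (lt_dec j m) as [Hjm|Hjm].
  + destruct (Hzeta j Hjm) as (A1 & A2 & A3 & A4).
    split; [exact A2|]. split; [exact A3|]. split; [exact A4|].
    intros t Ht. now apply A1.
  + assert (j = m) by lia. subst j. rewrite Hpm, Hvm.
    split; [apply hol_const|]. split; [reflexivity|]. split; [apply cder_const|].
    intros t _. now rewrite Cmod_0.
- intros i j t Hij Ht. destruct (lt_dec i m) as [Him|]; [|lia].
  destruct (Hzeta i Him) as (A1 & _). destruct (A1 t Ht) as (P1 & Q1 & _).
  assert (Q : forall k, 1 <= l -> 0 < Re (psi l (zeta k t))) by (intros; now apply Re_psi_pos).
  assert (Pi := Q i Hl).
  destruct (lt_dec j m) as [Hjm|Hjm].
  (* Lifts on opposite sides differ in the sign of the real part. On the same side a collision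
     passes from [psi] to [zeta], to [w], by injectivity to [u], and so to a collision of the old
     points [S i] and [S j]. *)
  + destruct (Hzeta j Hjm) as (A2 & _). destruct (A2 t Ht) as (P2 & Q2 & _).
    assert (Pj := Q j Hl). intros E.
    assert (N1 : RtoC (-1) = (- RtoC 1)%C) by (apply C_ext; simpl; ring).
    assert (Eq : zeta j t = zeta i t).
    { apply (f_equal Re) in E as ER. rewrite !Re_scal in ER.
      apply (psi_inj l); try assumption.
      destruct (Hsign i Him) as [Si|Si], (Hsign j Hjm) as [Sj|Sj]; rewrite Si, Sj in ER, E.
      - replace (psi l (zeta j t)) with (RtoC 1 * psi l (zeta j t))%C by ring. rewrite E. ring.
      - exfalso; lra.
      - exfalso; lra.
      - replace (psi l (zeta j t)) with (- (RtoC (-1) * psi l (zeta j t)))%C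
          by (rewrite N1; ring). rewrite E, N1. ring. }
    assert (Ew : w j t = w i t) by (rewrite <- Q1, <- Q2, Eq; reflexivity).
    assert (Ht' : square r' t) by (apply square_mono with r; [lra|exact Ht]).
    assert (Eu : u j t = u i t).
    { destruct (Hu i t Him Ht'), (Hu j t Hjm Ht'). apply (Hinj t); try assumption; lra. }
    apply (Hdis (S i) (S j) t); [lia|exact Ht'|].
    replace (z (S j) t) with (u j t + z 0%nat t)%C by (unfold u; ring).
    rewrite Eu. unfold u. ring.
  + intros E. apply (f_equal Re) in E. rewrite Re_scal in E.
    change (0 = sign (p i) * Re (psi l (zeta i t))) in E.
    destruct (Hsign i Him) as [Si|Si]; rewrite Si in E; lra.
Qed.

(** If [v m = 0], then [v] is an eigenvector for [lam] of the operator by which plain lifting acts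
    on velocities: [v_j] goes to [(v_(j+1) - v_0) / dflat(p_j)] for [j < m], and the last velocity
    to 0. *)
Lemma no_eigenvalue_ge_1 (l b x0 rad lam : R) (m : nat) (p v : nat -> R) :
  1 <= l -> 0 < b -> 0 < x0 -> rad = flat l b x0 -> 2 * x0 < rad -> 1 <= lam ->
  (forall j, (j < m)%nat -> p (S j) - p 0%nat = flat l b (p j) /\ p j <> 0) ->
  p m = 0 ->
  (forall j, (j <= m)%nat -> Rabs (p j) < x0) ->
  (forall i j, (i < j <= m)%nat -> p j <> p i) ->
  v 0%nat = 1 -> (forall j, (j < m)%nat -> v (S j) = 1 + lam * dflat l b (p j) * v j) ->
  v m <> 0.
Proof.
intros Hl Hb Hx0 Hrad Hrad2 Hlam Hp Hpm Hpx Hpd Hv0 Hv Hvm.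
destruct (polyfun_interpolation (fun j => RtoC (p (S j) - p 0%nat))
   (fun j => RtoC (dflat l b (p j) * v j)) m) as (h & Hh & Hh0 & Hhi).
{ intros i Hi. apply RtoC_neq. rewrite (proj1 (Hp i Hi)). pose proof (flat_pos l b (p i) Hb). lra. }
{ intros i j Hij Hj. apply RtoC_neq. intros E. apply (Hpd (S i) (S j)); [lia|lra]. }
destruct (polyfun_lipschitz h (2 * x0) Hh) as (K & HK0 & HK); [lra|].
(* Velocities [s v] lift to [(lam s + 1) v], the 1 being due to [h]; with [lam >= 1] the factor
   after [n] lifts is at least [n]. *)
set (s := fix s (n : nat) : R := match n with O => 0 | S n => lam * s n + 1 end).
assert (Hs : forall n, INR n <= s n).
{ induction n as [|n IH]; [simpl; lra|]. rewrite S_INR. simpl. pose proof (pos_INR n). nra. }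
(* On the square [|t| <= 2 * eps]; the first bound gives [|t| K < 1], the second spends at most the
   slack [rad - 2 * x0]. Using [K + 1] avoids dividing by zero. *)
set (eps := Rmin (1 / (4 * (K + 1))) ((rad - 2 * x0) / (8 * x0 * (K + 1)))).
assert (Heps : 0 < eps).
{ apply Rmin_glb_lt; apply Rdiv_lt_0_compat; nra. }
assert (Hsmall : forall t, square eps t -> Cmod t * K < 1 /\ 2 * x0 * (1 + Cmod t * K) <= rad).
{ intros t [B1 B2]. pose proof (Cmod_le_abs t) as B. pose proof (Cmod_ge_0 t).
  assert (C1 : eps <= 1 / (4 * (K + 1))) by apply Rmin_l.
  assert (C2 : eps <= (rad - 2 * x0) / (8 * x0 * (K + 1))) by apply Rmin_r.
  assert (C1' : eps * (4 * (K + 1)) <= 1).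
  { apply (Rmult_le_compat_r (4 * (K + 1))) in C1; [|lra].
    replace (1 / (4 * (K + 1)) * (4 * (K + 1))) with 1 in C1 by (field; lra). exact C1. }
  assert (C2' : eps * (8 * x0 * (K + 1)) <= rad - 2 * x0).
  { apply (Rmult_le_compat_r (8 * x0 * (K + 1))) in C2; [|nra].
    replace ((rad - 2 * x0) / (8 * x0 * (K + 1)) * (8 * x0 * (K + 1))) with (rad - 2 * x0) in C2
      by (field; lra). exact C2. }
  assert (Cmod t * K <= 2 * eps * K) by (apply Rmult_le_compat_r; lra).
  split; [nra|]. assert (x0 * (Cmod t * K) <= x0 * (2 * eps * K)) by (apply Rmult_le_compat_l; lra).
  nra. }
(* Quantifying over all [r < eps] absorbs the shrinking: the previous motion is taken on radius
   [(r + eps) / 2], so any number of lifts is available on radius [eps / 2]. *)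
assert (Claim : forall n r, 0 < r < eps -> exists z, motion m x0 p (fun j => s n * v j) r z).
{ induction n as [|n IH]; intros r Hr.
  - exists (fun j _ => RtoC (p j)).
    destruct (motion_const m x0 p r Hpx Hpd) as [M1 M2]. split; [|exact M2].
    intros j Hj. simpl. rewrite Rmult_0_l. now apply M1.
  - destruct (IH ((r + eps) / 2)) as [z Hz]; [lra|].
    apply (motion_lift l b x0 rad K r ((r + eps) / 2) m p (fun j => s n * v j)
      (fun j => s (S n) * v j) h (fun j => dflat l b (p j) * v j) z); try assumption; try lra.
    + rewrite Hvm. ring.
    + intros j Hj. rewrite Hv0, (Hv j Hj). simpl. ring.
    + intros t Ht. apply Hsmall, square_mono with (2 := Ht). lra. }
(* The bound of [cauchy_estimate] for a function of modulus below [x0] on radius [eps / 2]; point 0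
   has velocity [s n] because [v 0 = 1]. *)
destruct (INR_unbounded (4 * x0 / (eps / 2))) as [n Hn].
destruct (Claim n (eps / 2)) as [z [Hz _]]; [lra|].
destruct (Hz 0%nat) as (H1 & _ & H2 & H3); [lia|].
assert (Hc : Re (RtoC (s n * v 0%nat)) <= 4 * x0 / (eps / 2)).
{ apply (cauchy_estimate (eps / 2) x0 (z 0%nat)); try assumption; [lra|].
  intros t Ht. left. now apply H3. }
simpl in Hc. rewrite Hv0 in Hc. specialize (Hs n). lra.
Qed.

(** * Transversality along the real family *)

Lemma is_derive_flat (l b x : R) : x <> 0 -> is_derive (flat l b) x (dflat l b x).
Proof.
intros Hx. unfold flat, Rpower.
assert (0 < Rabs x) by now apply Rabs_pos_lt.
pose proof (exp_pos (l * ln (Rabs x))).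
auto_derive.
- repeat split; try assumption. lra.
- unfold dflat, flat, Rpower. pose proof (sign_mult_abs x) as Hs.
  assert (E : sign x = x / Rabs x) by (rewrite <- Hs at 2; field; lra).
  assert (E2 : Rabs x * Rabs x = x * x) by (rewrite <- Rabs_mult; apply Rabs_pos_eq; nra).
  replace (1 * sign x * / Rabs x) with (/ x).
  + field. repeat split; try assumption; lra.
  + rewrite E. replace (1 * (x / Rabs x) * / Rabs x) with (x / (Rabs x * Rabs x)) by (field; lra).
    rewrite E2. field. exact Hx.
Qed.

Definition crit (l b : R) (k : nat) (c : R) : R := Nat.iter k (flat_map l b c) 0.

Lemma flat_map_0 (l b c : R) : flat_map l b c 0 = c.
Proof. unfold flat_map. destruct (Req_EM_T 0 0); [reflexivity|tauto]. Qed.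

Lemma flat_map_flat (l b c x : R) : x <> 0 -> flat_map l b c x = flat l b x + c.
Proof. intros H. unfold flat_map. destruct (Req_EM_T x 0); [tauto|reflexivity]. Qed.

Lemma crit_1 (l b c : R) : crit l b 1 c = c.
Proof. apply flat_map_0. Qed.

Lemma crit_S (l b c : R) (k : nat) : crit l b (S k) c = flat_map l b c (crit l b k c).
Proof. reflexivity. Qed.

(* [lam = 1] gives the derivative of [c |-> f_c^(j+1)(0)]. *)
Fixpoint velocity (l b : R) (p : nat -> R) (lam : R) (j : nat) : R :=
  match j with
  | O => 1
  | S j => 1 + lam * dflat l b (p j) * velocity l b p lam j
  end.

(** Nonzero orbit points stay nonzero for nearby parameters, so locally [flat_map] is the smooth
    expression [flat] plus the parameter and the chain rule gives the recursion. *)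
Lemma is_derive_crit (l b c : R) (j : nat) :
  (forall k, (k < j)%nat -> crit l b (S k) c <> 0) ->
  is_derive (crit l b (S j)) c (velocity l b (fun k => crit l b (S k) c) 1 j).
Proof.
induction j as [|j IH]; intros Hn.
- apply is_derive_ext with (fun c => c); [intros t; symmetry; apply crit_1|].
  apply (is_derive_id (K := R_AbsRing)).
- assert (D := IH (fun k Hk => Hn k ltac:(lia))).
  assert (Hj := Hn j ltac:(lia)).
  assert (Hc : continuous (crit l b (S j)) c).
  { apply (ex_derive_continuous (K := R_AbsRing) (V := R_NormedModule)). eexists; exact D. }
  apply is_derive_ext_loc with (fun y => flat l b (crit l b (S j) y) + y).
  + apply (filter_imp (fun y => crit l b (S j) y <> 0)).
    * intros y Hy. rewrite (crit_S l b y (S j)), flat_map_flat by exact Hy. reflexivity.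
    * apply (Hc (fun x => x <> 0)). apply (open_neq 0). exact Hj.
  + assert (E : forall u d : R, plus (scal u d) (one : R) = 1 + 1 * d * u).
    { intros u d. unfold plus, scal, one; simpl. unfold mult; simpl. ring. }
    simpl velocity. rewrite <- E.
    apply (is_derive_plus (K := R_AbsRing) (V := R_NormedModule)
      (fun y => flat l b (crit l b (S j) y)) (fun y => y)).
    * apply (is_derive_comp (K := R_AbsRing) (V := R_NormedModule) (flat l b)); [|exact D].
      now apply is_derive_flat.
    * apply (is_derive_id (K := R_AbsRing)).
Qed.

Fixpoint iprod (f : nat -> R) (n : nat) : R :=
  match n with O => 1 | S n => iprod f n * f n end.

Lemma iprod_S (f : nat -> R) (n : nat) : iprod f (S n) = iprod f n * f n.
Proof. reflexivity. Qed.

(** [prod_f_R0] never has an empty product; [iprod] starts from one, hence the shift by one. *)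
Lemma iprod_prod_f_R0 (f : nat -> R) (n : nat) : prod_f_R0 f n = iprod f (S n).
Proof.
induction n as [|n IH]; [simpl; ring|].
change (prod_f_R0 f (S n)) with (prod_f_R0 f n * f (S n)). rewrite IH. reflexivity.
Qed.

Lemma iprod_ext (f g : nat -> R) (n : nat) :
  (forall k, (k < n)%nat -> f k = g k) -> iprod f n = iprod g n.
Proof.
induction n as [|n IH]; intros H; [reflexivity|].
simpl. rewrite IH, H by (intros; try apply H; lia). reflexivity.
Qed.

Lemma iprod_neq0 (f : nat -> R) (n : nat) :
  (forall k, (k < n)%nat -> f k <> 0) -> iprod f n <> 0.
Proof.
induction n as [|n IH]; intros H; simpl; [lra|].
apply Rmult_integral_contrapositive_currified; [apply IH; intros; apply H; lia|apply H; lia].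
Qed.

Lemma iprod_0_inv (f : nat -> R) (n : nat) :
  iprod f n = 0 -> exists k, (k < n)%nat /\ f k = 0.
Proof.
intros H. apply NNPP. intros Hn. revert H. apply iprod_neq0.
intros k Hk E. apply Hn. now exists k.
Qed.

Lemma iprod_mult (f g : nat -> R) (n : nat) :
  iprod (fun k => f k * g k) n = iprod f n * iprod g n.
Proof. induction n as [|n IH]; simpl; [ring|]. rewrite IH. ring. Qed.

Lemma iprod_pos (f : nat -> R) (n : nat) :
  (forall k, (k < n)%nat -> 0 < f k) -> 0 < iprod f n.
Proof.
induction n as [|n IH]; intros H; simpl; [lra|].
apply Rmult_lt_0_compat; [apply IH; intros; apply H; lia|apply H; lia].
Qed.

(* Rescaling [u_j = tau^j v_j(1/tau)] turns the behaviour at [lam = oo] into [tau = 0]. *)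
Lemma velocity_sign (l b : R) (p : nat -> R) (m : nat) :
  1 <= l -> 0 < b -> (forall j, (j < m)%nat -> p j <> 0) ->
  (forall lam, 1 <= lam -> velocity l b p lam m <> 0) ->
  0 < velocity l b p 1 m * iprod (fun j => sign (p j)) m.
Proof.
intros Hl Hb Hp Hv.
set (D := fun j => dflat l b (p j)).
set (u := fix u (j : nat) (tau : R) : R :=
   match j with O => 1 | S j => tau ^ (S j) + D j * u j tau end).
assert (Uc : forall j tau, continuity_pt (u j) tau).
{ induction j as [|j IH]; intros tau.
  - apply continuity_pt_const. intros x y; reflexivity.
  - change (u (S j)) with (plus_fct (fun t => t ^ S j) (mult_real_fct (D j) (u j))).
    apply continuity_pt_plus.
    + apply derivable_continuous_pt, derivable_pt_pow.
    + apply (continuity_pt_scal (u j)), IH. }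
assert (U0 : forall j, u j 0 = iprod D j).
{ induction j as [|j IH]; [reflexivity|]. simpl. rewrite IH. ring. }
assert (Uv : forall j tau, tau <> 0 -> u j tau = tau ^ j * velocity l b p (/ tau) j).
{ induction j as [|j IH]; intros tau Ht; simpl; [ring|]. rewrite IH by exact Ht.
  fold (D j). field. exact Ht. }
assert (U1 : u m 1 = velocity l b p 1 m).
{ rewrite Uv by lra. rewrite Rinv_1, pow1. ring. }
(* [flat] is even and increasing in [|x|], so its derivative has the sign of the point. *)
assert (HD : forall j, (j < m)%nat -> 0 < D j * sign (p j)).
{ intros j Hj. specialize (Hp j Hj). unfold D, dflat.
  pose proof (flat_pos l b (p j) Hb). pose proof (exp_pos (l * ln (Rabs (p j)))) as He.
  fold (Rpower (Rabs (p j)) l) in He.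
  assert (0 < Rabs (p j)) by now apply Rabs_pos_lt.
  assert (Es : sign (p j) = p j / Rabs (p j)).
  { rewrite <- (sign_mult_abs (p j)) at 2. field. lra. }
  rewrite Es.
  replace (flat l b (p j) * (l / (Rpower (Rabs (p j)) l * p j)) * (p j / Rabs (p j)))
    with (flat l b (p j) * l / (Rpower (Rabs (p j)) l * Rabs (p j)))
    by (field; repeat split; lra).
  apply Rdiv_lt_0_compat; apply Rmult_lt_0_compat; lra. }
(* At [tau = 0] the recursion collapses to the product of the derivatives along the orbit; a
   disagreement of sign at [tau = 1] would force a zero in between. *)
assert (HP : 0 < u m 0 * iprod (fun j => sign (p j)) m).
{ rewrite U0, <- iprod_mult. now apply iprod_pos. }
assert (Hnz : forall tau, 0 <= tau <= 1 -> u m tau <> 0).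
{ intros tau Ht. destruct (Req_dec tau 0) as [->|Hn].
  - intros E. rewrite E in HP. lra.
  - rewrite Uv by exact Hn. apply Rmult_integral_contrapositive_currified.
    + now apply pow_nonzero.
    + apply Hv. rewrite <- Rinv_1. apply Rinv_le_contravar; lra. }
rewrite <- U1. set (s := iprod (fun j => sign (p j)) m) in *.
assert (Hs : s <> 0) by (intros E; rewrite E in HP; lra).
apply Rnot_le_lt. intros Hle.
assert (Hcs : continuity (fun t => - (s * u m t))).
{ intros t. apply continuity_pt_opp, (continuity_pt_scal (u m)), Uc. }
destruct (IVT_cor (fun t => - (s * u m t)) 0 1 Hcs) as [t [Ht Et]]; [lra|nra|].
apply (Hnz t Ht). apply (Rmult_eq_reg_l s); [lra|exact Hs].
Qed.

Lemma flat_incr (l b x y : R) : 1 <= l -> 0 < b -> 0 < x < y -> flat l b x < flat l b y.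
Proof.
intros Hl Hb H. unfold flat. rewrite !Rabs_pos_eq by lra.
apply Rmult_lt_compat_l; [exact Hb|]. apply exp_increasing, Ropp_lt_contravar.
apply Rinv_lt_contravar.
- apply Rmult_lt_0_compat; apply exp_pos.
- apply Rlt_Rpower_l; lra.
Qed.

Lemma iter_add (f : R -> R) (m n : nat) (x : R) :
  Nat.iter (m + n) f x = Nat.iter m f (Nat.iter n f x).
Proof. induction m as [|m IH]; [reflexivity|]. simpl. now rewrite IH. Qed.

(** What remains for [no_eigenvalue_ge_1] is that the periodic critical orbit is confined to
    [(-x0, x0)] and has distinct points. *)
Lemma positive_transversality (l b beta x0 rad c : R) (m : nat) :
  1 <= l -> 0 < b -> 0 < beta < x0 -> flat l b beta = 2 * beta ->
  rad = flat l b x0 -> 2 * x0 < rad -> - beta <= c ->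
  (forall k, (k < m)%nat -> crit l b (S k) c <> 0) -> crit l b (S m) c = 0 ->
  0 < velocity l b (fun k => crit l b (S k) c) 1 m
    * iprod (fun k => sign (crit l b (S k) c)) m.
Proof.
intros Hl Hb Hbeta Hfb Hrad Hrad2 Hc Hn Hm.
set (p := fun k => crit l b (S k) c).
assert (Hp0 : p 0%nat = c) by apply crit_1.
assert (Hstep : forall j, (j < m)%nat -> p (S j) = flat l b (p j) + c).
{ intros j Hj. unfold p. rewrite (crit_S l b c (S j)). apply flat_map_flat. now apply Hn. }
(* Backwards from time [m]: a point above [beta] is sent above [2 * beta + c >= beta], so the orbit
   could not come back to 0. *)
assert (Hup : forall k j, (j + k = m)%nat -> p j <= beta).
{ induction k as [|k IH]; intros j Hj.
  - replace j with m by lia. unfold p. rewrite Hm. lra.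
  - apply Rnot_lt_le. intros Hlt. specialize (IH (S j) ltac:(lia)).
    rewrite (Hstep j) in IH by lia.
    pose proof (flat_incr l b beta (p j) Hl Hb ltac:(lra)). lra. }
assert (Hc0 : c <= beta) by (rewrite <- Hp0; apply (Hup m); lia).
assert (Hlow : forall j, (j <= m)%nat -> - beta <= p j).
{ intros [|j] Hj; [lra|]. rewrite Hstep by lia. pose proof (flat_pos l b (p j) Hb). lra. }
apply velocity_sign; try assumption.
intros lam Hlam.
apply (no_eigenvalue_ge_1 l b x0 rad lam m p (velocity l b p lam)); try assumption; try lra.
- intros j Hj. split; [rewrite Hstep, Hp0 by exact Hj; ring|now apply Hn].
- intros j Hj. specialize (Hlow j Hj). assert (p j <= beta) by (apply (Hup (m - j)%nat); lia).
  apply Rabs_def1; lra.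
(* If the points [i] and [j] coincided, applying the remaining [m - j] steps to the earlier one
   would reach 0 before time [m]. *)
- intros i j Hij E.
  apply (Hn (i + (m - j))%nat); [lia|].
  unfold p, crit in *.
  replace (S (i + (m - j))) with ((m - j) + S i)%nat by lia.
  rewrite iter_add, <- E, <- iter_add.
  replace ((m - j) + S j)%nat with (S m) by lia. exact Hm.
- reflexivity.
- intros j _. reflexivity.
Qed.

(** * Monotonicity of the kneading sequence *)

Lemma least_witness (P : nat -> Prop) :
  (exists n, P n) -> exists n, P n /\ forall k, (k < n)%nat -> ~ P k.
Proof.
intros [n Hn]. revert Hn. induction n as [n IH] using lt_wf_ind. intros Hn.
destruct (classic (exists k, (k < n)%nat /\ P k)) as [(k & Hk & Ek)|Hno].
- now apply (IH k).
- exists n. split; [exact Hn|]. intros k Hk Ek. apply Hno. now exists k.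
Qed.

(** The two-sided comparison at the supremum replaces continuity, which fails for the step functions
    in question: its left half puts the supremum in the set, its right half moves beyond it. *)
Lemma locally_nondecreasing (f : R -> R) (a b : R) :
  a <= b ->
  (forall x, a <= x <= b -> exists d, 0 < d /\ forall y, Rabs (y - x) < d ->
     (y <= x -> f y <= f x) /\ (x <= y -> f x <= f y)) ->
  f a <= f b.
Proof.
intros Hab Hf.
set (E := fun x => a <= x <= b /\ f a <= f x).
destruct (completeness E) as [s [Hs1 Hs2]].
{ exists b. intros x [Hx _]. lra. }
{ exists a. split; lra. }
assert (Has : a <= s) by (apply Hs1; split; lra).
assert (Hsb : s <= b) by (apply Hs2; intros x [Hx _]; lra).
destruct (Hf s ltac:(lra)) as (d & Hd & H).
assert (Hfs : f a <= f s).
{ apply NNPP. intros Hn. assert (Hub : is_upper_bound E (s - d)).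
  { intros x [Hx Hfx]. apply Rnot_lt_le. intros Hlt. apply Hn.
    assert (x <= s) by (apply Hs1; split; assumption).
    destruct (H x) as [H1 _]; [apply Rabs_def1; lra|]. specialize (H1 ltac:(lra)). lra. }
  specialize (Hs2 _ Hub). lra. }
destruct (Rle_lt_or_eq_dec s b Hsb) as [Hlt| ->]; [|exact Hfs].
exfalso.
set (y := Rmin b (s + d / 2)).
assert (Hy : s < y) by (apply Rmin_glb_lt; lra).
assert (Hy1 : y <= b) by apply Rmin_l. assert (Hy2 : y <= s + d / 2) by apply Rmin_r.
destruct (H y) as [_ H2]; [apply Rabs_def1; lra|].
assert (y <= s); [|lra]. apply Hs1. split; [lra|]. specialize (H2 ltac:(lra)). lra.
Qed.

(* Turns the lexicographic order on the sequences of signed products into the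
   order of the reals. *)
Fixpoint dyadic (a : nat -> R) (n : nat) : R :=
  match n with O => 0 | S n => dyadic a n + a n / 2 ^ n end.

Lemma dyadic_ext (a b : nat -> R) (n : nat) :
  (forall k, (k < n)%nat -> a k = b k) -> dyadic a n = dyadic b n.
Proof.
induction n as [|n IH]; intros H; [reflexivity|].
simpl. rewrite IH, (H n) by (intros; try apply H; lia). reflexivity.
Qed.

Lemma dyadic_opp (a : nat -> R) (n : nat) : dyadic (fun k => - a k) n = - dyadic a n.
Proof.
induction n as [|n IH]; simpl; [ring|]. rewrite IH. unfold Rdiv. ring.
Qed.

(** Place [m] contributes a lead of [2^(-m)], more than any finite stretch of later weights can add
    up to. Weights in base 2 suffice because the tail of [b] is zero. *)
Lemma dyadic_lexi (a b : nat -> R) (m n : nat) :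
  (m < n)%nat -> (forall k, (k < m)%nat -> a k = b k) ->
  a m = 1 -> (forall k, Rabs (a k) <= 1) -> (forall k, (m <= k)%nat -> b k = 0) ->
  dyadic b n <= dyadic a n.
Proof.
intros Hmn Hk Ham Ha Hb.
(* The lead that is still guaranteed is exactly the weight of the last place taken into account; it
   halves at each step. *)
assert (Claim : forall j, dyadic b (S m + j) + / 2 ^ (m + j) <= dyadic a (S m + j)).
{ induction j as [|j IH].
  - rewrite !Nat.add_0_r. simpl. rewrite (dyadic_ext a b m Hk), Ham, (Hb m) by lia.
    unfold Rdiv. lra.
  - replace (S m + S j)%nat with (S (S m + j)) by lia.
    replace (m + S j)%nat with (S (m + j)) by lia.
    change (dyadic b (S (S m + j))) with (dyadic b (S m + j) + b (S m + j)%nat / 2 ^ (S m + j)).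
    change (dyadic a (S (S m + j))) with (dyadic a (S m + j) + a (S m + j)%nat / 2 ^ (S m + j)).
    rewrite (Hb (S m + j)%nat) by lia.
    change (S m + j)%nat with (S (m + j)) in *. 
    assert (Hp : 0 < / 2 ^ S (m + j)) by (apply Rinv_0_lt_compat, pow_lt; lra).
    assert (E : / 2 ^ (m + j) = 2 * / 2 ^ S (m + j)).
    { simpl. field. apply pow_nonzero. lra. }
    rewrite E in IH. specialize (Ha (S (m + j))). apply Rabs_le_between in Ha.
    unfold Rdiv. nra. }
specialize (Claim (n - S m)%nat).
replace (S m + (n - S m))%nat with n in Claim by lia.
assert (0 < / 2 ^ (m + (n - S m))) by (apply Rinv_0_lt_compat, pow_lt; lra).
lra.
Qed.

(** Once the critical orbit hits 0 these products remain 0, which supplies the vanishing tail asked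
    for by [dyadic_lexi]. *)
Definition theta (l b c : R) (k : nat) : R :=
  iprod (fun j => sign (crit l b (S j) c)) (S k).

Lemma Rabs_sign_le (x : R) : Rabs (sign x) <= 1.
Proof.
destruct (Rtotal_order x 0) as [H|[->|H]].
- rewrite sign_eq_m1, Rabs_left by lra. lra.
- rewrite sign_0, Rabs_R0. lra.
- rewrite sign_eq_1, Rabs_pos_eq by lra. lra.
Qed.

Lemma Rabs_iprod_sign_le (f : nat -> R) (n : nat) : Rabs (iprod (fun j => sign (f j)) n) <= 1.
Proof.
induction n as [|n IH]; simpl; [rewrite Rabs_R1; lra|].
rewrite Rabs_mult. pose proof (Rabs_sign_le (f n)).
pose proof (Rabs_pos (iprod (fun j => sign (f j)) n)). pose proof (Rabs_pos (sign (f n))). nra.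
Qed.

Lemma sign_locally_const (g : R -> R) (c : R) :
  continuous g c -> g c <> 0 ->
  locally c (fun y => sign (g y) = sign (g c)).
Proof.
intros Hc Hn. destruct (Rtotal_order (g c) 0) as [H|[H|H]]; [|tauto|].
- apply (filter_imp (fun y => g y < 0)).
  + intros y Hy. rewrite !sign_eq_m1 by assumption. reflexivity.
  + apply (Hc (fun x => x < 0)). now apply (open_lt 0).
- apply (filter_imp (fun y => 0 < g y)).
  + intros y Hy. rewrite !sign_eq_1 by assumption. reflexivity.
  + apply (Hc (fun x => 0 < x)). now apply (open_gt 0).
Qed.

Lemma crit_sign_locally_const (l b c : R) (m : nat) :
  (forall k, (k < m)%nat -> crit l b (S k) c <> 0) ->
  locally c (fun y => forall k, (k < m)%nat -> sign (crit l b (S k) y) = sign (crit l b (S k) c)).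
Proof.
induction m as [|m IH]; intros Hn.
- apply filter_forall. intros; lia.
- assert (L : locally c (fun y => sign (crit l b (S m) y) = sign (crit l b (S m) c))).
  { apply sign_locally_const; [|apply Hn; lia].
    apply (ex_derive_continuous (K := R_AbsRing) (V := R_NormedModule)).
    eexists. apply is_derive_crit. intros k Hk. apply Hn. lia. }
  assert (IH' := IH (fun k Hk => Hn k ltac:(lia))).
  generalize (filter_and _ _ L IH'). apply filter_imp.
  intros y [A B] k Hk. destruct (Nat.eq_dec k m) as [->|]; [exact A|apply B; lia].
Qed.

Lemma is_derive_sign_change (g : R -> R) (c d s : R) :
  is_derive g c d -> g c = 0 -> 0 < d * s ->
  locally c (fun y => y <> c -> 0 < g y * s * (y - c)).
Proof.
intros Hd Hg Hs. apply is_derive_Reals in Hd.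
assert (Hs0 : s <> 0) by (intros ->; lra).
assert (Hsp : 0 < Rabs s) by now apply Rabs_pos_lt.
(* As [d * s > 0], this tolerance is [|d|]: difference quotients then keep the sign of [d], which is
   that of [s]. *)
destruct (Hd (d * s / Rabs s)) as [e He]; [now apply Rdiv_lt_0_compat|].
exists e. intros y Hy Hn. change R in y.
specialize (He (y - c) ltac:(lra) Hy). replace (c + (y - c)) with y in He by ring.
rewrite Hg in He. set (q := (g y - 0) / (y - c)) in *.
assert (Eq : g y = q * (y - c)) by (unfold q; field; lra).
assert (B : Rabs ((q - d) * s) < d * s).
{ rewrite Rabs_mult. apply (Rmult_lt_compat_r (Rabs s)) in He; [|exact Hsp].
  replace (d * s / Rabs s * Rabs s) with (d * s) in He by (field; lra). exact He. }
apply Rabs_def2 in B. rewrite Eq.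
replace (q * (y - c) * s * (y - c)) with (q * s * ((y - c) * (y - c))) by ring.
apply Rmult_lt_0_compat; nra.
Qed.

(** Only the first hit of 0 matters, at place [m] say: earlier products are locally constant, and by
    transversality the product at [m] is -1 to the left of [c] and 1 to the right, against 0 at [c].
    With no hit among the first [n] places the whole sum is locally constant. *)
Lemma theta_locally_nondecreasing (l b beta x0 rad c : R) (n : nat) :
  1 <= l -> 0 < b -> 0 < beta < x0 -> flat l b beta = 2 * beta ->
  rad = flat l b x0 -> 2 * x0 < rad -> - beta <= c ->
  locally c (fun y => (y <= c -> dyadic (theta l b y) n <= dyadic (theta l b c) n) /\
                      (c <= y -> dyadic (theta l b c) n <= dyadic (theta l b y) n)).
Proof.
intros Hl Hb Hbeta Hfb Hrad Hrad2 Hc.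
destruct (classic (exists m, (m < n)%nat /\ crit l b (S m) c = 0)) as [Hex|Hno].
- destruct (least_witness _ Hex) as (m & [Hm Em] & Hmin).
  assert (Hlt : forall k, (k < m)%nat -> crit l b (S k) c <> 0).
  { intros k Hk Ek. apply (Hmin k Hk). split; [lia|exact Ek]. }
  pose proof (positive_transversality l b beta x0 rad c m Hl Hb Hbeta Hfb Hrad Hrad2 Hc Hlt Em) as Hpt.
  pose proof (is_derive_sign_change _ _ _ _ (is_derive_crit l b c m Hlt) Em Hpt) as L1.
  pose proof (crit_sign_locally_const l b c m Hlt) as L2.
  generalize (filter_and _ _ L1 L2). apply filter_imp. clear L1 L2. intros y [A B]. change R in y.
  set (s := iprod (fun k => sign (crit l b (S k) c)) m) in *.
  assert (Hb0 : forall k, (m <= k)%nat -> theta l b c k = 0).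
  { intros k Hk. unfold theta. induction Hk as [|k Hk IH].
    - rewrite iprod_S, Em, sign_0. ring.
    - rewrite iprod_S, IH. ring. }
  assert (Hlow : forall k, (k < m)%nat -> theta l b y k = theta l b c k).
  { intros k Hk. apply iprod_ext. intros j Hj. apply B. lia. }
  assert (Hth : theta l b y m = s * sign (crit l b (S m) y)).
  { unfold theta. rewrite iprod_S. f_equal. apply iprod_ext. exact B. }
  assert (Hs : s = 1 \/ s = -1).
  { assert (H1 : Rabs s <= 1) by apply Rabs_iprod_sign_le.
    assert (Q : forall j, (j <= m)%nat -> iprod (fun k => sign (crit l b (S k) c)) j = 1 \/
       iprod (fun k => sign (crit l b (S k) c)) j = -1).
    { induction j as [|j IH]; intros Hj; [left; reflexivity|]. rewrite iprod_S.
      assert (E : sign (crit l b (S j) c) = 1 \/ sign (crit l b (S j) c) = -1).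
      { apply sign_cases, Hlt. lia. }
      destruct (IH ltac:(lia)) as [-> | ->], E as [-> | ->]; lra. }
    now apply Q. }
  assert (Hab : forall k, Rabs (theta l b y k) <= 1) by (intros k; apply Rabs_iprod_sign_le).
  split; intros Hy.
  + destruct (Req_dec y c) as [->|Hn]; [lra|]. specialize (A Hn).
    assert (Hm1 : theta l b y m = -1).
    { rewrite Hth. destruct Hs as [Hs|Hs]; rewrite Hs in *.
      - rewrite sign_eq_m1 by nra. ring.
      - rewrite sign_eq_1 by nra. ring. }
    (* To the left the entry is -1; changing all signs brings it to the form of [dyadic_lexi]. *)
    apply Ropp_le_cancel. rewrite <- !dyadic_opp. apply dyadic_lexi with m; try assumption.
    * intros k Hk. now rewrite Hlow.
    * rewrite Hm1. ring.
    * intros k. now rewrite Rabs_Ropp.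
    * intros k Hk. rewrite Hb0 by exact Hk. ring.
  + destruct (Req_dec y c) as [->|Hn]; [lra|]. specialize (A Hn).
    assert (Hm1 : theta l b y m = 1).
    { rewrite Hth. destruct Hs as [Hs|Hs]; rewrite Hs in *.
      - rewrite sign_eq_1 by nra. ring.
      - rewrite sign_eq_m1 by nra. ring. }
    apply dyadic_lexi with m; assumption.
- assert (Hall : forall k, (k < n)%nat -> crit l b (S k) c <> 0).
  { intros k Hk E. apply Hno. now exists k. }
  generalize (crit_sign_locally_const l b c n Hall). apply filter_imp. intros y Hy.
  assert (E : dyadic (theta l b y) n = dyadic (theta l b c) n).
  { apply dyadic_ext. intros k Hk. apply iprod_ext. intros j Hj. apply Hy. lia. }
  rewrite E. split; intros; lra.
Qed.

(** At the first place where the sequences differ, the dyadic sums compare exactly the products at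
    that place; it remains to exclude that these are equal. *)
Lemma kneading_monotone (l b beta x0 rad c c' : R) :
  1 <= l -> 0 < b -> 0 < beta < x0 -> flat l b beta = 2 * beta ->
  rad = flat l b x0 -> 2 * x0 < rad -> - beta <= c -> c <= c' ->
  kneading_le (kneading (flat_map l b c)) (kneading (flat_map l b c')).
Proof.
intros Hl Hb Hbeta Hfb Hrad Hrad2 Hc Hcc.
assert (Hmon : forall n, dyadic (theta l b c) n <= dyadic (theta l b c') n).
{ intros n. apply (locally_nondecreasing (fun c => dyadic (theta l b c) n)); [exact Hcc|].
  intros x Hx.
  destruct (theta_locally_nondecreasing l b beta x0 rad x n Hl Hb Hbeta Hfb Hrad Hrad2 ltac:(lra))
    as [d Hd].
  exists d. split; [apply cond_pos|]. intros y Hy. now apply Hd. }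
destruct (classic (exists n, kneading (flat_map l b c) n <> kneading (flat_map l b c') n)) as [Hex|Hno].
2:{ left. intros k. apply NNPP. intros H. apply Hno. now exists k. }
right.
destruct (least_witness _ Hex) as (n & Hn & Hmin).
assert (Hlt : forall k, (k < n)%nat -> kneading (flat_map l b c) k = kneading (flat_map l b c') k).
{ intros k Hk. apply NNPP. exact (Hmin k Hk). }
exists n. split; [exact Hlt|].
rewrite !iprod_prod_f_R0.
specialize (Hmon (S n)). simpl dyadic in Hmon.
change (iprod (kneading (flat_map l b c)) (S n) < iprod (kneading (flat_map l b c')) (S n)).
assert (Hth : forall y k, theta l b y k = iprod (kneading (flat_map l b y)) (S k)) by reflexivity.
rewrite (dyadic_ext (theta l b c) (theta l b c') n) in Hmon.
2:{ intros k Hk. rewrite !Hth. apply iprod_ext. intros j Hj. apply Hlt. lia. }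
assert (H2 : 0 < / 2 ^ n) by (apply Rinv_0_lt_compat, pow_lt; lra).
rewrite !Hth in Hmon. unfold Rdiv in Hmon.
destruct (Rle_lt_or_eq_dec (iprod (kneading (flat_map l b c)) (S n))
  (iprod (kneading (flat_map l b c')) (S n))) as [H|H]; [nra|exact H|].
exfalso. simpl in H. rewrite <- (iprod_ext _ _ n Hlt) in H.
(* If the common prefix has product 0, both critical orbits return to 0 at the same earlier time, so
   entry [n] repeats an entry on which the sequences agree. Otherwise the prefix cancels. *)
destruct (Req_dec (iprod (kneading (flat_map l b c)) n) 0) as [E|E].
- destruct (iprod_0_inv _ _ E) as (k & Hk & Ek).
  assert (Per : forall y, kneading (flat_map l b y) k = 0 ->
    kneading (flat_map l b y) n = kneading (flat_map l b y) (n - S k)).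
  { intros y Hy. unfold kneading in *.
    assert (Hz : Nat.iter (S k) (flat_map l b y) 0 = 0).
    { apply NNPP. intros Q. destruct (sign_cases _ Q); lra. }
    replace (S n) with (S (n - S k) + S k)%nat by lia. rewrite iter_add, Hz. reflexivity. }
  apply Hn. rewrite (Per c Ek), (Per c') by (rewrite <- Hlt; assumption).
  apply Hlt. lia.
- apply Hn. now apply Rmult_eq_reg_l in H.
Qed.

(** * The covering [F_0] *)

(** [true] stands for [Uplus] and [false] for [Uminus], so that U is parametrised uniformly by
    [sg s (psi l zeta)]. *)
Definition sg (s : bool) (z : C) : C := if s then z else (- z)%C.

Lemma sg_sg (s : bool) (z : C) : sg s (sg s z) = z.
Proof. destruct s; simpl; ring. Qed.

Lemma Cmod_sg (s : bool) (z : C) : Cmod (sg s z) = Cmod z.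
Proof. destruct s; simpl; [reflexivity|apply Cmod_opp]. Qed.

Lemma Re_Copp (z : C) : Re (- z)%C = - Re z.
Proof. reflexivity. Qed.

Lemma continuous_sg {T : UniformSpace} (s : bool) (f : T -> C) (x : T) :
  Ccont T f x -> Ccont T (fun t => sg s (f t)) x.
Proof. destruct s; simpl; [auto|apply continuous_Copp]. Qed.

(** Inversion takes a disc with 0 on its boundary to a half-plane: both sides say
    [|z|^2 < rho * Re z]. *)
Lemma disc_diam_inv (rho : R) (z : C) :
  0 < rho -> z <> RtoC 0 -> (disc_diam 0 rho z <-> / rho < Re (/ z)%C).
Proof.
intros Hr Hz. unfold disc_diam, open_disc.
assert (Hn : 0 < Re z ^ 2 + Im z ^ 2).
{ rewrite <- Cmod2_alt. apply pow_lt. now apply Cmod_gt_0. }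
assert (E : Re (/ z)%C = Re z / (Re z ^ 2 + Im z ^ 2)) by reflexivity.
assert (E2 : Cmod (z - RtoC ((0 + rho) / 2)) ^ 2 = Re z ^ 2 + Im z ^ 2 - rho * Re z + (rho / 2) ^ 2).
{ rewrite Cmod2_alt. simpl. unfold Re, Im. field. }
pose proof (Cmod_ge_0 (z - RtoC ((0 + rho) / 2))) as Hc.
set (c := Cmod (z - RtoC ((0 + rho) / 2))) in *. set (n := Re z ^ 2 + Im z ^ 2) in *.
rewrite E. split; intros H.
- assert (n < rho * Re z) by nra.
  apply (Rmult_lt_reg_r (rho * n)); [nra|].
  replace (/ rho * (rho * n)) with n by (field; lra).
  replace (Re z / n * (rho * n)) with (rho * Re z) by (field; lra). assumption.
- assert (n < rho * Re z).
  { apply (Rmult_lt_compat_r (rho * n)) in H; [|nra].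
    replace (/ rho * (rho * n)) with n in H by (field; lra).
    replace (Re z / n * (rho * n)) with (rho * Re z) in H by (field; lra). assumption. }
  apply Rnot_le_lt. intros Hle. nra.
Qed.

Lemma Uplus_psi (l x0 : R) (z : C) : 1 <= l ->
  (Uplus l x0 z <-> exists zeta, / Rpower x0 l < Re zeta /\ z = psi l zeta).
Proof.
intros Hl. assert (Hp : 0 < Rpower x0 l) by apply exp_pos.
assert (Hi : 0 < / Rpower x0 l) by now apply Rinv_0_lt_compat.
split.
- intros [(r & t & Hr & Ht & Ez) Hd].
  assert (Ez2 : z = Cexp (ln r, t)).
  { rewrite Ez. unfold Cexp. simpl. now rewrite exp_ln. }
  assert (Ht2 : Rabs t < PI / 2).
  { eapply Rlt_le_trans; [exact Ht|now apply PI2l_le]. }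
  assert (EC : Clog z = (ln r, t)) by (rewrite Ez2; apply Clog_Cexp; exact Ht2).
  exists (/ Phi l z)%C. split.
  + apply disc_diam_inv; [exact Hp|apply Phi_neq0|exact Hd].
  + symmetry. apply psi_Phi; [exact Hl| |].
    * rewrite Ez2. apply Re_Cexp_pos. exact Ht2.
    * rewrite EC, Rabs_mult, (Rabs_pos_eq l) by lra.
      change (Im (ln r, t)) with t.
      replace (PI / 2) with (l * (PI / (2 * l))) by (field; lra).
      apply Rmult_lt_compat_l; lra.
- intros (zeta & Hz & ->). assert (Hz0 : 0 < Re zeta) by lra. split.
  + exists (exp (Re (RtoC (- / l) * Clog zeta)%C)), (Im (RtoC (- / l) * Clog zeta)%C).
    split; [apply exp_pos|]. split; [now apply psi_arg|reflexivity].
  + rewrite Phi_psi by assumption. pose proof (Re_pos_neq0 _ Hz0) as Hn.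
    assert (Hn' : (/ zeta)%C <> RtoC 0).
    { apply Cmod_gt_0. rewrite Cmod_inv by exact Hn. now apply Rinv_0_lt_compat, Cmod_gt_0. }
    apply disc_diam_inv; [exact Hp|exact Hn'|].
    replace (/ / zeta)%C with zeta by (field; exact Hn). exact Hz.
Qed.

Lemma Udom_psi (l x0 : R) (z : C) : 1 <= l ->
  (Udom l x0 z <-> exists s zeta, / Rpower x0 l < Re zeta /\ z = sg s (psi l zeta)).
Proof.
intros Hl. unfold Udom, Uminus. rewrite !Uplus_psi by exact Hl. split.
- intros [(zeta & H & ->)|(zeta & H & E)].
  + now exists true, zeta.
  + exists false, zeta. split; [exact H|]. simpl. rewrite <- E. ring.
- intros ([|] & zeta & H & ->).
  + left. now exists zeta.
  + right. exists zeta. split; [exact H|]. simpl. ring.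
Qed.

Lemma Rpower_inv_pos (x l : R) : 0 < / Rpower x l.
Proof. apply Rinv_0_lt_compat, exp_pos. Qed.

Lemma F0_psi (l b : R) (s : bool) (zeta : C) :
  1 <= l -> 0 < Re zeta -> F0 l b (sg s (psi l zeta)) = (RtoC b * Cexp (- zeta))%C.
Proof.
intros Hl Hz. pose proof (Re_psi_pos l zeta Hl) as Hp.
pose proof (Re_pos_neq0 _ Hz) as Hn.
assert (E : (- / Phi l (psi l zeta))%C = (- zeta)%C).
{ rewrite Phi_psi by assumption. field. exact Hn. }
unfold F0. destruct s; simpl sg.
- destruct (Rlt_dec 0 (Re (psi l zeta))); [|tauto]. now rewrite E.
- destruct (Rlt_dec 0 (Re (- psi l zeta)%C)) as [H|H].
  + rewrite Re_Copp in H. lra.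
  + replace (- - psi l zeta)%C with (psi l zeta) by ring. now rewrite E.
Qed.

Lemma cder_F0 (l b : R) (z : C) : Re z <> 0 -> exists d, cder (F0 l b) z d.
Proof.
intros Hz.
assert (K : forall u, 0 < Re u ->
  exists d, cder (fun w => RtoC b * Cexp (- / Phi l w))%C u d).
{ intros u Hu. eexists. apply cder_scal.
  apply (cder_comp Cexp (fun w => - / Phi l w)%C); [apply cder_Cexp|].
  apply (cder_opp (fun w => / Phi l w)%C), (cder_inv (Phi l)); [|apply Phi_neq0].
  apply cder_ext_loc with (fun w => Cexp (RtoC l * Clog w)).
  - apply filter_forall. intros w. symmetry. apply Phi_Clog.
  - apply (cder_comp Cexp (fun w => RtoC l * Clog w)%C); [apply cder_Cexp|].
    apply cder_scal. now apply cder_Clog. }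
destruct (Rlt_le_dec 0 (Re z)) as [H|H].
- destruct (K z H) as [d Hd]. exists d. apply cder_ext_loc with (2 := Hd).
  apply (filter_imp (fun w : C_UniformSpace => 0 < Re w)).
  + intros w Hw. unfold F0. destruct (Rlt_dec 0 (Re w)); [reflexivity|tauto].
  + apply (continuous_Re (fun w : C_UniformSpace => w) z (continuous_id z) (fun x => 0 < x)).
    now apply (open_gt 0).
- assert (Hneg : Re z < 0) by lra.
  destruct (K (- z)%C) as [d Hd]; [rewrite Re_Copp; lra|].
  exists (d * (- RtoC 1))%C.
  apply cder_ext_loc with (fun w => RtoC b * Cexp (- / Phi l (- w)))%C.
  + apply (filter_imp (fun w : C_UniformSpace => Re w < 0)).
    * intros w Hw. unfold F0. destruct (Rlt_dec 0 (Re w)); [lra|reflexivity].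
    * apply (continuous_Re (fun w : C_UniformSpace => w) z (continuous_id z) (fun x => x < 0)).
      now apply (open_lt 0).
  + apply (cder_comp (fun w => RtoC b * Cexp (- / Phi l w))%C (fun w => - w)%C); [exact Hd|].
    apply (cder_opp (fun w => w)), cder_id.
Qed.

Lemma Udom_Re_neq0 (l x0 : R) (z : C) : 1 <= l -> Udom l x0 z -> Re z <> 0.
Proof.
intros Hl H. apply Udom_psi in H; [|exact Hl]. destruct H as ([|] & zeta & H & ->); simpl sg;
  pose proof (Re_psi_pos l zeta Hl); [lra|rewrite Re_Copp; lra].
Qed.

Lemma Udom_Cmod (l x0 : R) (z : C) : 1 <= l -> 0 < x0 -> Udom l x0 z -> Cmod z < x0.
Proof.
intros Hl Hx H. apply Udom_psi in H; [|exact Hl]. destruct H as (s & zeta & H & ->).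
rewrite Cmod_sg. now apply Cmod_psi_lt.
Qed.

Lemma Udom_R (l x0 t : R) : 1 <= l -> 0 < t < x0 -> Udom l x0 (RtoC t) /\ Udom l x0 (RtoC (- t)).
Proof.
intros Hl Ht.
assert (H : / Rpower x0 l < Re (RtoC (/ Rpower t l))).
{ simpl. apply Rinv_lt_contravar; [apply Rmult_lt_0_compat; apply exp_pos|].
  apply Rlt_Rpower_l; lra. }
split; apply Udom_psi; try exact Hl.
- exists true, (RtoC (/ Rpower t l)). split; [exact H|]. simpl. now rewrite psi_R by lra.
- exists false, (RtoC (/ Rpower t l)). split; [exact H|]. simpl.
  now rewrite psi_R, RtoC_opp by lra.
Qed.

(** Pulls neighbourhoods back along the coordinate [1 / Phi] of a component; it yields the openness
    of U and of the sheets. *)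
Lemma locally_Phi_inv (l : R) (s : bool) (z : C) (P : C -> Prop) :
  0 < Re (sg s z) -> @locally C_UniformSpace (/ Phi l (sg s z))%C P ->
  @locally C_UniformSpace z (fun w => 0 < Re (sg s w) /\ P (/ Phi l (sg s w))%C).
Proof.
intros Hz HP.
assert (Hs : Ccont C_UniformSpace (sg s) z) by (apply (continuous_sg s (fun w => w)), continuous_id).
apply filter_and.
- apply (continuous_Re (sg s) z Hs (fun x => 0 < x)). now apply (open_gt 0).
- assert (Hc : Ccont C_UniformSpace (fun w => / Phi l (sg s w))%C z).
  { apply continuous_ext with (fun w => / Cexp (RtoC l * Clog (sg s w)))%C.
    { intros w. now rewrite Phi_Clog. }
    apply continuous_Cinv; [|apply Cexp_neq0].
    apply continuous_Cexp_fun, continuous_Cmult; [apply continuous_const|].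
    now apply continuous_Clog_fun. }
  exact (Hc P HP).
Qed.

Lemma open_Udom (l x0 : R) : 1 <= l -> @open C_UniformSpace (Udom l x0).
Proof.
intros Hl z Hz. apply Udom_psi in Hz; [|exact Hl]. destruct Hz as (s & zeta & Hz & ->).
pose proof (Rpower_inv_pos x0 l) as Hi.
assert (Hp := Re_psi_pos l zeta Hl).
assert (E : (/ Phi l (sg s (sg s (psi l zeta))))%C = zeta).
{ rewrite sg_sg, Phi_psi by lra. field. apply Re_pos_neq0. lra. }
assert (L1 := locally_Phi_inv l s (sg s (psi l zeta)) (fun u => / Rpower x0 l < Re u)).
rewrite E, sg_sg in L1. specialize (L1 Hp).
assert (L2 : @locally C_UniformSpace zeta (fun u => / Rpower x0 l < Re u)).
{ apply (continuous_Re (fun w : C_UniformSpace => w) zeta (continuous_id zeta)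
    (fun x => / Rpower x0 l < x)). now apply (open_gt (/ Rpower x0 l)). }
specialize (L1 L2).
(* Nearby points must also stay in the sector; only there does [psi] recover them from [1 / Phi]. *)
assert (L3 : @locally C_UniformSpace (sg s (psi l zeta))
   (fun w => Rabs (l * Im (Clog (sg s w))) < PI / 2)).
{ assert (Hc : continuous (fun w : C_UniformSpace => Rabs (l * Im (Clog (sg s w)))) (sg s (psi l zeta))).
  { apply (continuous_Rcomp Rabs); [|apply Rcontinuity_abs].
    apply continuous_Rmult; [apply continuous_const|].
    apply continuous_Im, continuous_Clog_fun.
    - apply (continuous_sg s (fun w => w)), continuous_id.
    - now rewrite sg_sg. }
  apply (Hc (fun x => x < PI / 2)). apply (open_lt (PI / 2)).
  rewrite sg_sg, Clog_psi, Im_scal by exact Hl.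
  replace (l * (- / l * Im (Clog zeta))) with (- Im (Clog zeta)) by (field; lra).
  rewrite Rabs_Ropp. apply Im_Clog_bound. }
generalize (filter_and _ _ L1 L3). apply filter_imp. intros w [[A B] D].
apply Udom_psi; [exact Hl|]. exists s, (/ Phi l (sg s w))%C. split; [exact B|].
now rewrite psi_Phi, sg_sg.
Qed.

(** A half turn or a quarter turn brings any nonzero [w] into the right half-plane, where [Clog]
    applies. *)
Lemma Cexp_surj (w : C) : w <> RtoC 0 -> exists z, Cexp z = w.
Proof.
intros Hw.
assert (K : forall y u : C, (Cexp u * y)%C = w -> 0 < Re y -> exists z, Cexp z = w).
{ intros y u E Hy. exists (u + Clog y)%C. rewrite Cexp_plus, Cexp_Clog by exact Hy. exact E. }
assert (E1 : Cexp (0, PI) = (- RtoC 1)%C).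
{ unfold Cexp, polar; simpl. rewrite exp_0, cos_PI, sin_PI. apply C_ext; simpl; ring. }
assert (E2 : Cexp (0, PI / 2) = Ci).
{ unfold Cexp, polar; simpl. rewrite exp_0, cos_PI2, sin_PI2. apply C_ext; simpl; ring. }
assert (E3 : Cexp (- (0, PI / 2)) = (- Ci)%C).
{ rewrite Cexp_opp, E2. apply C_ext; simpl; field. }
destruct (Rtotal_order (Re w) 0) as [H|[H|H]].
- apply (K (- w)%C (0, PI)); [rewrite E1; ring|rewrite Re_Copp; lra].
- assert (Hi : Im w <> 0) by (intros E; apply Hw; apply C_ext; assumption).
  destruct (Rtotal_order (Im w) 0) as [H'|[H'|H']]; [|tauto|].
  + apply (K (Ci * w)%C (- (0, PI / 2)%R)%C).
    * rewrite E3. destruct w. apply C_ext; simpl; ring.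
    * simpl. unfold Im in H'. lra.
  + apply (K (- Ci * w)%C (0, PI / 2)).
    * rewrite E2. destruct w. apply C_ext; simpl; ring.
    * simpl. unfold Im in H'. lra.
- apply (K w (RtoC 0)); [rewrite Cexp_R, exp_0; ring|exact H].
Qed.

Lemma continuous_on_continuous (A : C -> Prop) (f : C -> C) :
  (forall z, A z -> Ccont C_UniformSpace f z) ->
  @continuous_on C_UniformSpace C_UniformSpace A f.
Proof.
intros H z Hz. eapply filterlim_filter_le_1; [apply filter_le_within|].
exact (H z Hz).
Qed.

Section Covering.
Variables (l b x0 rad : R).
Hypotheses (Hl : 1 <= l) (Hb : 0 < b) (Hx0 : 0 < x0) (Hrad : rad = b * exp (- / Rpower x0 l)).

Let X := punctured (Udom l x0).
Let Y := punctured (open_disc (RtoC 0) rad).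

(** Every point of U has nonzero real part, so puncturing at 0 removes nothing. *)
Lemma punctured_Udom (z : C) :
  X z <-> exists s zeta, / Rpower x0 l < Re zeta /\ z = sg s (psi l zeta).
Proof.
unfold X, punctured. rewrite <- Udom_psi by exact Hl. split; [tauto|].
intros H. split; [exact H|]. intros E.
apply (Udom_Re_neq0 l x0 z Hl H). rewrite E. reflexivity.
Qed.

Lemma punctured_disc_Cexp (zeta : C) :
  Y (RtoC b * Cexp (- zeta))%C <-> / Rpower x0 l < Re zeta.
Proof.
unfold Y, punctured, open_disc.
replace (RtoC b * Cexp (- zeta) - RtoC 0)%C with (RtoC b * Cexp (- zeta))%C by ring.
rewrite Cmod_mult, Cmod_R, Cmod_Cexp, Re_Copp, (Rabs_pos_eq b), Hrad by lra. split.
- intros [H _]. apply Rmult_lt_reg_l in H; [|exact Hb]. apply exp_lt_inv in H. lra.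
- intros H. split.
  + apply Rmult_lt_compat_l; [exact Hb|]. apply exp_increasing. lra.
  + apply Cmult_neq_0; [apply RtoC_neq; lra|apply Cexp_neq0].
Qed.

Lemma punctured_disc_log (w : C) :
  Y w -> exists zeta, w = (RtoC b * Cexp (- zeta))%C /\ / Rpower x0 l < Re zeta.
Proof.
intros Hw. assert (Hb0 : RtoC b <> RtoC 0) by (apply RtoC_neq; lra).
destruct (Cexp_surj (w / RtoC b)) as [u Hu].
{ destruct Hw as [_ Hw]. intros E. apply Hw.
  replace w with (w / RtoC b * RtoC b)%C by (field; exact Hb0). rewrite E. ring. }
assert (E : w = (RtoC b * Cexp (- - u))%C).
{ replace (- - u)%C with u by ring. rewrite Hu. field. exact Hb0. }
exists (- u)%C. split; [exact E|]. apply punctured_disc_Cexp. now rewrite <- E.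
Qed.

(** On this half of the punctured disc [Clog (w / w0)] is a single-valued logarithm; on the whole of
    it there is none. *)
Definition half_disc (w0 : C) : C -> Prop := fun w => Y w /\ 0 < Re (w / w0)%C.

(* Sheet [k] on side [s], with [b exp (- zeta0)] the base point. *)
Definition sheet (zeta0 : C) (i : Z * bool) : C -> Prop := fun z =>
  exists zeta, / Rpower x0 l < Re zeta /\ z = sg (snd i) (psi l zeta) /\
    Rabs (Im (zeta0 - zeta - two_pi_i (fst i))%C) < PI / 2.

Lemma sg_psi_inj (s s' : bool) (u v : C) :
  0 < Re u -> 0 < Re v -> sg s (psi l u) = sg s' (psi l v) -> s = s' /\ u = v.
Proof.
intros Hu Hv E. pose proof (Re_psi_pos l u Hl). pose proof (Re_psi_pos l v Hl).
assert (Es : s = s').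
{ apply (f_equal Re) in E. destruct s, s'; simpl sg in E; try reflexivity;
  rewrite ?Re_Copp in E; lra. }
subst s'. split; [reflexivity|]. apply (psi_inj l); try assumption.
rewrite <- (sg_sg s (psi l u)), E, sg_sg. reflexivity.
Qed.

Lemma ratio_Cexp (u v : C) :
  (RtoC b * Cexp (- v) / (RtoC b * Cexp (- u)))%C = Cexp (u - v)%C.
Proof.
assert (Hb0 : RtoC b <> RtoC 0) by (apply RtoC_neq; lra).
unfold Cminus. rewrite Cexp_plus, !Cexp_opp. pose proof (Cexp_neq0 u). pose proof (Cexp_neq0 v).
field. tauto.
Qed.

Lemma evenly_covered_half_disc (zeta0 : C) :
  let w0 := (RtoC b * Cexp (- zeta0))%C in evenly_covered (F0 l b) X (half_disc w0).
Proof.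
intros w0. pose proof (Rpower_inv_pos x0 l) as Hi.
assert (Hb0 : RtoC b <> RtoC 0) by (apply RtoC_neq; lra).
assert (Hw0 : w0 <> RtoC 0) by (apply Cmult_neq_0; [exact Hb0|apply Cexp_neq0]).
assert (HX : forall i z, sheet zeta0 i z -> X z).
{ intros i z (zeta & H1 & H2 & _). apply punctured_Udom. now exists (snd i), zeta. }
assert (HW : forall i z, sheet zeta0 i z -> half_disc w0 (F0 l b z)).
{ intros i z (zeta & H1 & -> & H3). rewrite F0_psi by lra. split.
  - now apply punctured_disc_Cexp.
  - unfold w0. rewrite ratio_Cexp.
    replace (zeta0 - zeta)%C with ((zeta0 - zeta - two_pi_i (fst i)) + two_pi_i (fst i))%C by ring.
    rewrite Cexp_period. now apply Re_Cexp_pos. }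
exists (Z * bool)%type, (sheet zeta0). split; [|split; [|split]].
- intros i.
  (* The sheet condition with [zeta] read off as [1 / Phi]; membership in U is left to the factor
     [X] of a relatively open set. *)
  exists (fun z => 0 < Re (sg (snd i) z) /\
    Rabs (Im (zeta0 - / Phi l (sg (snd i) z) - two_pi_i (fst i))%C) < PI / 2).
  split.
  + intros z [Hz1 Hz2].
    apply (locally_Phi_inv l (snd i) z
      (fun u => Rabs (Im (zeta0 - u - two_pi_i (fst i))%C) < PI / 2)); [exact Hz1|].
    set (u0 := (/ Phi l (sg (snd i) z))%C) in *.
    assert (Hc : continuous (fun u : C_UniformSpace => Rabs (Im (zeta0 - u - two_pi_i (fst i))%C)) u0).
    { apply (continuous_Rcomp Rabs); [|apply Rcontinuity_abs].
      apply continuous_Im. repeat apply continuous_Cminus; try apply continuous_const.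
      apply continuous_id. }
    apply (Hc (fun x => x < PI / 2)). now apply (open_lt (PI / 2)).
  + intros z. split.
    * intros Hz. split; [now apply (HX i)|]. destruct Hz as (zeta & H1 & -> & H3).
      rewrite sg_sg. split; [now apply Re_psi_pos|].
      rewrite Phi_psi by lra. replace (/ / zeta)%C with zeta; [exact H3|].
      field. apply Re_pos_neq0. lra.
    * intros [Hz [H1 H2]]. apply punctured_Udom in Hz. destruct Hz as (s & zeta & Hz & ->).
      pose proof (Re_psi_pos l zeta Hl) as Hp.
      assert (Es : snd i = s).
      { destruct (snd i), s; simpl sg in H1; try reflexivity; rewrite ?Re_Copp in H1; lra. }
      rewrite Es, sg_sg, Phi_psi in H2 by lra.
      exists zeta. split; [exact Hz|]. split; [now rewrite Es|].
      replace zeta with (/ / zeta)%C; [exact H2|]. field. apply Re_pos_neq0. lra.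
- intros z. split.
  + intros [Hz [_ Hre]]. apply punctured_Udom in Hz. destruct Hz as (s & zeta & Hz & ->).
    rewrite F0_psi in Hre by lra. unfold w0 in Hre. rewrite ratio_Cexp in Hre.
    (* The sheet number counts by how many periods [zeta0 - zeta] differs from the principal
       logarithm of its exponential. *)
    destruct (Cexp_eq (zeta0 - zeta) (Clog (Cexp (zeta0 - zeta)))) as [k Hk].
    { now rewrite Cexp_Clog. }
    exists (k, s), zeta. split; [exact Hz|]. split; [reflexivity|]. simpl fst.
    rewrite Hk at 1.
    replace (Clog (Cexp (zeta0 - zeta)) + two_pi_i k - two_pi_i k)%C
      with (Clog (Cexp (zeta0 - zeta))) by ring.
    apply Im_Clog_bound.
  + intros [i Hz]. split; [now apply (HX i)|now apply (HW i)].
- intros [k s] [k' s'] z (zeta & H1 & E1 & B1) (zeta' & H2 & E2 & B2). simpl in *.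
  rewrite E1 in E2. apply sg_psi_inj in E2; try lra. destruct E2 as [-> <-]. f_equal.
  change (Rabs (Im (zeta0 - zeta)%C + - (2 * PI * IZR k)) < PI / 2) in B1.
  change (Rabs (Im (zeta0 - zeta)%C + - (2 * PI * IZR k')) < PI / 2) in B2.
  apply Rabs_def2 in B1. apply Rabs_def2 in B2. pose proof PI_RGT_0 as Hpi.
  (* Both [2 * PI * k] and [2 * PI * k'] lie within [PI / 2] of the same number, so the integers
     differ by less than 1. *)
  assert (A1 : IZR k < IZR (k' + 1)) by (rewrite plus_IZR; nra).
  assert (A2 : IZR k' < IZR (k + 1)) by (rewrite plus_IZR; nra).
  apply lt_IZR in A1. apply lt_IZR in A2. lia.
- intros i. split; [|split].
  + apply continuous_on_continuous. intros z Hz. apply HX in Hz. destruct Hz as [Hz _].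
    destruct (cder_F0 l b z) as [d Hd]; [now apply (Udom_Re_neq0 l x0)|].
    apply cder_continuous with (1 := Hd).
  + intros z. apply HW.
  (* The equation [b exp(-zeta) = w] solved for [zeta], with the branch prescribed by the sheet
     number. *)
  + set (inv := fun w => (zeta0 - two_pi_i (fst i) - Clog (w / w0))%C).
    assert (Hexp : forall w, 0 < Re (w / w0)%C -> (RtoC b * Cexp (- inv w))%C = w).
    { intros w Hw.
      replace (- inv w)%C with ((- zeta0 + Clog (w / w0)) + two_pi_i (fst i))%C by (unfold inv; ring).
      rewrite Cexp_period, Cexp_plus, Cexp_Clog by exact Hw.
      unfold w0. field. split; [apply Cexp_neq0|exact Hb0]. }
    assert (Hinv : forall w, half_disc w0 w -> / Rpower x0 l < Re (inv w)).
    { intros w [Hw1 Hw2]. apply punctured_disc_Cexp. now rewrite Hexp. }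
    exists (fun w => sg (snd i) (psi l (inv w))). split; [|split; [|split]].
    * apply continuous_on_continuous. intros w Hw.
      apply continuous_sg, continuous_psi.
      -- apply continuous_Cminus; [apply continuous_const|].
         apply continuous_Clog_fun; [|apply Hw].
         apply continuous_Cmult; [apply continuous_id|apply continuous_const].
      -- specialize (Hinv w Hw). lra.
    * intros w Hw. exists (inv w). split; [now apply Hinv|]. split; [reflexivity|].
      replace (zeta0 - inv w - two_pi_i (fst i))%C with (Clog (w / w0)) by (unfold inv; ring).
      apply Im_Clog_bound.
    * intros z (zeta & H1 & -> & H3). rewrite F0_psi by lra. unfold inv, w0. rewrite ratio_Cexp.
      replace (zeta0 - zeta)%C with ((zeta0 - zeta - two_pi_i (fst i)) + two_pi_i (fst i))%C by ring.
      rewrite Cexp_period, Clog_Cexp by exact H3. f_equal. f_equal. ring.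
    * intros w Hw. rewrite F0_psi by (try exact Hl; specialize (Hinv w Hw); lra).
      apply Hexp, Hw.
Qed.

Lemma covering_F0 : Defs.covering (F0 l b) X Y.
Proof.
pose proof (Rpower_inv_pos x0 l) as Hi.
split; [|split; [|split]].
- apply continuous_on_continuous. intros z [Hz _].
  destruct (cder_F0 l b z) as [d Hd]; [now apply (Udom_Re_neq0 l x0)|].
  apply cder_continuous with (1 := Hd).
- intros z Hz. apply punctured_Udom in Hz. destruct Hz as (s & zeta & Hz & ->).
  rewrite F0_psi by lra. now apply punctured_disc_Cexp.
- intros w Hw. destruct (punctured_disc_log w Hw) as (zeta & -> & Hz).
  exists (sg true (psi l zeta)). split.
  + apply punctured_Udom. now exists true, zeta.
  + apply F0_psi; lra.
- intros w Hw. destruct (punctured_disc_log w Hw) as (zeta & E & Hz).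
  exists (half_disc w). assert (Hn : w <> RtoC 0) by apply Hw.
  split; [|split].
  + exists (fun u => 0 < Re (u / w)%C). split.
    * intros u Hu.
      assert (Hc : Ccont C_UniformSpace (fun v => v / w)%C u)
        by (apply continuous_Cmult; [apply continuous_id|apply continuous_const]).
      apply (continuous_Re _ u Hc (fun x => 0 < x)). now apply (open_gt 0).
    * intros u. reflexivity.
  + split; [exact Hw|]. replace (w / w)%C with (RtoC 1) by (field; exact Hn). simpl. lra.
  + rewrite E. apply evenly_covered_half_disc.
Qed.

End Covering.

(** * The diameter of U, membership in the class, and the separation property *)

Lemma diam_Udom (l x0 : R) : 1 <= l -> 0 < x0 -> diam (Udom l x0) = 2 * x0.
Proof.
intros Hl Hx. unfold diam.
rewrite (is_lub_Rbar_unique _ (Finite (2 * x0))); [reflexivity|]. split.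
- intros d (z & w & Hz & Hw & ->). simpl.
  apply Udom_Cmod in Hz; try assumption. apply Udom_Cmod in Hw; try assumption.
  unfold Cminus. eapply Rle_trans; [apply Cmod_triangle|]. rewrite Cmod_opp. lra.
- intros B HB.
  assert (H : forall t, 0 < t < x0 -> Rbar_le (2 * t) B).
  { intros t Ht. apply HB. destruct (Udom_R l x0 t Hl Ht) as [H1 H2].
    exists (RtoC t), (RtoC (- t)). split; [exact H1|]. split; [exact H2|].
    rewrite <- RtoC_minus, Cmod_R, Rabs_pos_eq by lra. ring. }
  destruct B as [B| |]; simpl.
  + apply Rnot_lt_le. intros Hlt.
    (* A point strictly between [B / 2] and [x0], positive even if [B] is not; the pair [t], [-t] in
       U is then more than [B] apart. *)
    set (t := (Rmax (B / 2) 0 + x0) / 2).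
    assert (B / 2 <= Rmax (B / 2) 0) by apply Rmax_l.
    assert (0 <= Rmax (B / 2) 0) by apply Rmax_r.
    assert (Rmax (B / 2) 0 < x0) by (apply Rmax_lub_lt; lra).
    specialize (H t). simpl in H. unfold t in H. lra.
  + exact I.
  + apply (H (x0 / 2)). lra.
Qed.

Lemma open_open_disc (x : C) (r : R) : @open C_UniformSpace (open_disc x r).
Proof.
apply open_Cmod. intros z Hz. unfold open_disc in *.
exists (r - Cmod (z - x)). split; [lra|]. intros w Hw.
replace (w - x)%C with ((w - z) + (z - x))%C by ring.
eapply Rle_lt_trans; [apply Cmod_triangle|]. lra.
Qed.

Lemma class_F_F0 (l b x0 rad : R) :
  1 <= l -> 0 < b -> 0 < x0 -> rad = b * exp (- / Rpower x0 l) -> 2 * x0 < rad ->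
  class_F (F0 l b) (Udom l x0) (open_disc (RtoC 0) rad).
Proof.
intros Hl Hb Hx Hrad H2.
pose proof (covering_F0 l b x0 rad Hl Hb Hrad) as Hcov.
split; [|split; [|split; [|split]]].
- split.
  + intros z Hz. destruct (cder_F0 l b z) as [d Hd]; [now apply (Udom_Re_neq0 l x0)|].
    exists d. now apply cder_is_derive.
  + intros z Hz. apply Hcov. split; [exact Hz|]. intros E.
    apply (Udom_Re_neq0 l x0 z Hl Hz). rewrite E. reflexivity.
- split; [now apply open_Udom|]. split.
  + exists x0. intros z Hz. left. now apply (Udom_Cmod l x0).
  + intros eps He. exists (RtoC (Rmin eps x0 / 2)).
    assert (0 < Rmin eps x0) by (apply Rmin_glb_lt; assumption).
    pose proof (Rmin_l eps x0). pose proof (Rmin_r eps x0). split.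
    * unfold open_disc. rewrite <- RtoC_minus, Cmod_R, Rabs_pos_eq; lra.
    * apply Udom_R; [exact Hl|lra].
- split; [apply open_open_disc|]. exists rad. intros z Hz. unfold open_disc in Hz.
  replace (z - RtoC 0)%C with z in Hz by ring. lra.
- exact Hcov.
- rewrite diam_Udom by assumption. split; intros z Hz; unfold open_disc in *.
  + lra.
  + replace (z - RtoC 0)%C with z by ring. apply Udom_Cmod in Hz; lra.
Qed.

Theorem corollary7p3 (l b beta x0 x1 rad : R)
  (hl : 1 <= l)
  (hb : 2 * Rpower (exp 1 * l) (1 / l) < b)
  (hbeta : 0 < beta < Rpower l (1 / l))
  (hbeta_eq : b = 2 * beta * exp (1 / Rpower beta l))
  (hx0 : beta < x0)
  (hx1 : x1 = flat_map l b (- beta) x0)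
  (hx1_gt : x0 < x1)
  (hx1_exp : 2 * (x0 - beta) < x1 - beta)
  (hrad : rad = flat_map l b 0 x0)
  (hrad_eq : rad = x1 + beta)
  (hrad_lt : rad < b) :
  class_F (F0 l b) (Udom l x0) (open_disc (RtoC 0) rad) /\
  (forall c : C, Udom l x0 c ->
     Csubset (closure (open_disc c (diam (Udom l x0)))) (open_disc c rad) /\
     Csubset (Udom l x0) (closure (open_disc c (diam (Udom l x0))))) /\
  (forall c c' : R, - beta <= c -> c <= c' ->
     kneading_le (kneading (flat_map l b c)) (kneading (flat_map l b c'))).
Proof.
assert (Hb : 0 < b).
{ rewrite hbeta_eq. apply Rmult_lt_0_compat; [lra|apply exp_pos]. }
assert (Hx : 0 < x0) by lra.
(* The expansion hypothesis: [rad = x1 + beta > 2 * (x0 - beta) + 2 * beta]. This is the inequality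
   [diam(U) < R]. *)
assert (H2 : 2 * x0 < rad) by lra.
assert (Hrad : rad = flat l b x0) by (rewrite hrad, flat_map_flat by lra; ring).
(* The equation defining [beta] says that [beta] is a fixed point of [f_(-beta)]. *)
assert (Hfb : flat l b beta = 2 * beta).
{ unfold flat. rewrite Rabs_pos_eq by lra. rewrite hbeta_eq, exp_Ropp.
  unfold Rdiv. rewrite Rmult_1_l. field. apply Rgt_not_eq, exp_pos. }
split; [|split].
- apply class_F_F0; try assumption. rewrite Hrad. unfold flat. now rewrite Rabs_pos_eq by lra.
- intros c Hc. rewrite diam_Udom by assumption. apply Udom_Cmod in Hc; try assumption.
  split; intros z Hz.
  (* A point of the closure is approximated to within the slack [rad - 2 * x0] by a point at
     distance below [2 * x0] from [c]. *)
  + destruct (Hz (rad - 2 * x0)) as (w & A & B); [lra|]. unfold open_disc in *.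
    replace (z - c)%C with (- (w - z) + (w - c))%C by ring.
    eapply Rle_lt_trans; [apply Cmod_triangle|]. rewrite Cmod_opp. lra.
  + intros eps He. exists z. unfold open_disc. split.
    * replace (z - z)%C with (RtoC 0) by ring. rewrite Cmod_0. exact He.
    * apply Udom_Cmod in Hz; try assumption.
      unfold Cminus. eapply Rle_lt_trans; [apply Cmod_triangle|]. rewrite Cmod_opp. lra.
- intros c c'. apply (kneading_monotone l b beta x0 rad); try assumption. lra.
Qed.
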